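(* Almost surely $$M'(\infty,1)=\xi\big(\mathcal{M}'_\infty(1)+2(\log\xi+\gamma-1)\big),$$ where $\gamma$ is the Euler constant, and $\mathcal{M}'_\infty(1)$ satisfies the almost sure version of the Quicksort equation: $$\mathcal{M}'_\infty(1)=U\,\mathcal{M}'_{\infty,(0)}(1)+(1-U)\,\mathcal{M}'_{\infty,(1)}(1)+2U\log U+2(1-U)\log(1-U)+1,$$ where $\mathcal{M}'_{\infty,(0)}(1)$ and $\mathcal{M}'_{\infty,(1)}(1)$ are independent (and independent of $U$), distributed as $\mathcal{M}'_\infty(1)$, and $U=\xi_0/(\xi_0+\xi_1)$ is uniform on $[0,1]$.
   Context: Let $\mathbb{U}=\{\emptyset\}\cup\bigcup_{n\ge1}\{0,1\}^n$ be the set of finite words on $\{0,1\}$; $|u|$ denotes the length (depth) of $u$. A complete binary tree is a finite subset $T\subset\mathbb{U}$ such that $\emptyset\in T$; $uv\in T\Rightarrow u\in T$; $u1\in T\Leftrightarrow u0\in T$. Its leaves, forming the set $\partial T$, are the nodes of $T$ with no strict descendants in $T$. Yule tree process $(\mathbb{T}_t)_{t\ge0}$: $\mathbb{T}_0=\{\emptyset\}$; each leaf $u$ carries an independent exponential clock of parameter 1, and when it rings $u$ becomes an internal node and two new leaves $u0,u1$ (with fresh independent clocks) are added. Let $N_t=\#\partial\mathbb{T}_t$ and $\tau_n=\inf\{t: N_t=n+1\}$ ($\tau_0=0$). The binary search tree (BST) process is constructed on the same probability space by $\mathcal{T}_n:=\mathbb{T}_{\tau_n}$, $n\ge0$. Martingales: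 $M(t,z):=\sum_{u\in\partial\mathbb{T}_t}z^{|u|}e^{t(1-2z)}$ and $\mathcal{M}_n(z):=\frac1{C_n(z)}\sum_{u\in\partial\mathcal{T}_n}z^{|u|}$ with $C_0(z)=1$, $C_n(z)=\prod_{k=0}^{n-1}\frac{k+2z}{k+1}$. Derivative martingales: $M'(t,z)=\frac{d}{dz}M(t,z)$, $\mathcal{M}'_n(z)=\frac{d}{dz}\mathcal{M}_n(z)$. At $z=1$ they converge almost surely, and $M'(\infty,1)$ and $\mathcal{M}'_\infty(1)$ denote the limits as $t\to\infty$ and $n\to\infty$. $\xi:=\lim_{t\to\infty}e^{-t}N_t$ almost surely; $\xi$ is exponential of parameter 1. For $i\in\{0,1\}$ let $\mathbb{T}^{(i)}_s=\{v\in\mathbb{U}: iv\in\mathbb{T}_{s+\tau_1}\}$, the tree process growing from node $i$ after its appearance at time $\tau_1$ (a Yule tree process). Let $N^{(i)}_s=\#\partial\mathbb{T}^{(i)}_s$, $\xi_i=\lim_s e^{-s}N_s^{(i)}$ a.s., and let $\mathcal{M}'_{\infty,(i)}(1)$ be the almost sure limit of the BST derivative martingale at $z=1$ built from $\mathbb{T}^{(i)}$ observed at its successive jump times, in the same way as $\mathcal{M}'_\infty(1)$ is built from $\mathbb{T}$. *)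

(* Defs.v *)
From HB Require Import structures.
From mathcomp Require Import all_boot all_order all_algebra.
From mathcomp Require Import finmap.
From mathcomp Require Import all_classical all_reals all_analysis.
Set Implicit Arguments.
Unset Strict Implicit.
Unset Printing Implicit Defensive.
Import Order.TTheory GRing.Theory Num.Theory.
Import numFieldNormedType.Exports.
Local Open Scope classical_set_scope.
Local Open Scope ring_scope.

(* Finite words on {0,1}, with false for 0 and true for 1; the depth |u| is
   [size u] and the concatenation uv is [u ++ v]. *)
Definition word := seq bool.

Section Trees.
Variable R : realType.
Implicit Types (A : set word) (T : R -> set word) (e : word -> R).

Definition leaves A : set word :=
  [set u | A u /\ forall v : word, v != [::] -> ~ A (u ++ v)].

(* [fset_set B] is empty when B is infinite; the trees below are almost surely
   finite at all times. *)
Definition leaf_fset A : {fset word} := fset_set (leaves A).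

Definition nleaves A : nat := #|` leaf_fset A|%fset.

(* When node u carries a clock of duration [e u], started at the birth of u,
   the birth time of u is the sum of the durations of the clocks of its strict
   ancestors, i.e. of its strict prefixes. *)
Definition birth e (u : word) : R := \sum_(k < size u) e (take k u).

Definition yule e (t : R) : set word := [set u | birth e u <= t].

(* The functionals below take the trajectory T : time -> tree as argument, so
   that they apply both to the whole process and to the two subtrees. *)

Definition jump_time T (n : nat) : R :=
  inf [set t | 0 <= t /\ nleaves (T t) = n.+1].

Definition bst T (n : nat) : set word := T (jump_time T n).

Definition yule_martingale T (t z : R) : R :=
  \sum_(u <- leaf_fset (T t)) z ^+ size u * expR (t * (1 - 2 * z)).

Definition bst_norm (n : nat) (z : R) : R :=
  \prod_(0 <= k < n) ((k%:R + 2 * z) / k.+1%:R).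

Definition bst_martingale T (n : nat) (z : R) : R :=
  (bst_norm n z)^-1 * \sum_(u <- leaf_fset (bst T n)) z ^+ size u.

Definition yule_derivative_martingale T (t z : R) : R :=
  derive1 (yule_martingale T t) z.

Definition bst_derivative_martingale T (n : nat) (z : R) : R :=
  derive1 (bst_martingale T n) z.

(* The tree growing from node i, its time origin being the birth time
   [jump_time T 1] of that node. *)
Definition subtree T (i : bool) (s : R) : set word :=
  [set v | T (s + jump_time T 1) (i :: v)].

Definition euler_gamma : R :=
  lim ((\sum_(1 <= k < n.+1) k%:R^-1 - ln n%:R : R) @[n --> \oo]).

End Trees.

Section Probability.
Context d (Omega : measurableType d) (R : realType) (P : probability Omega R).
Local Open Scope ereal_scope.

(* Only measurable sets matter: a measure has arbitrary values elsewhere. *)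
Definition has_law (X : Omega -> R) (mu : set R -> \bar R) : Prop :=
  forall A : set R, measurable A -> P (X @^-1` A) = mu A.

Definition mutually_independent (I : choiceType) (X : I -> Omega -> R) : Prop :=
  forall (s : seq I) (A : I -> set R), uniq s ->
    (forall i, measurable (A i)) ->
    P (\bigcap_(i in [set` s]) (X i @^-1` A i)) =
    \prod_(i <- s) P (X i @^-1` A i).

End Probability.

(* Main.v *)
Require Import Defs.
From HB Require Import structures.
From mathcomp Require Import all_boot all_order all_algebra.
From mathcomp Require Import finmap ring lra zify.
From mathcomp Require Import all_classical all_reals all_analysis.
From mathcomp Require Import measurable_realfun.
Set Implicit Arguments.
Unset Strict Implicit.
Unset Printing Implicit Defensive.
Import Order.TTheory GRing.Theory Num.Theory.
Import numFieldNormedType.Exports.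
Local Open Scope classical_set_scope.
Local Open Scope ring_scope.

(** Write [N] for the number of leaves of a tree, [L] for the sum of their
    depths and [H_n] for the harmonic sums.  Differentiating at 1 gives
      M'(t,1) = e^(-t) (L - 2 t N)   and   bst'_n(1) = L / N - 2 (H_N - 1),
    the second one at the time when N = n + 1.  Everything then comes from
    these two formulas and from the law of the tree with [n] internal nodes.

    The two almost sure identities hold along each regular trajectory.  At the
    n-th jump time [t], M'(t,1) = e^(-t) N (bst'_n(1) + 2 (H_N - t) - 2), and
    H_N - t tends to gamma + log xi because e^(-t) N tends to xi > 0; this is
    [yule_bst_limits].  Splitting [L] at the root expresses bst'_n(1) through
    the same quantity for the two subtrees at the root, with harmonic sums that
    become logarithms of the shares of the subtrees in the limit; this is
    [quicksort_limit].  Both need trajectories which do not explode, visit all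
    the sizes and have positive limits of e^(-t) N.

    For the laws, the probability that the Yule tree equals a given [A] during
    a whole time window is explicit ([window_spec_tree]): the probability that
    [A] is the current tree at the beginning of the window is a geometric factor
    which depends only on the size of [A], times the weight of its shape; that
    none of its leaves splits during the window depends on the size only.
    Summing over a grid of times, [A] is visited with probability exactly its
    weight ([prob_visits]).  The same formula shows that the process does not
    explode ([ae_good_clocks]) and that P (N_t >= x e^t) >= 1 - x, whence xi > 0
    ([ae_limit_gt0]).

    The weight of a tree with [n + 1] internal nodes is the product of the
    weights of its two subtrees divided by [n + 1]: the size of the left subtree
    is uniform, and given the sizes the two subtrees are independent binary
    search trees ([bst_mean_root]).  For bounded continuous [f], [g], [h], the expectation of
    f (share) g (left) h (right) is thus an average over the sizes, and a Cesaro
    argument shows that it converges to E f(U) E g(B) E h(B), with [U] uniform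
    and [B] the limit of bst'_n(1) ([expect_joint]).  As the variables inside
    converge almost surely, this determines the joint law of the share and of the
    two limits: independence, equality in law and uniformity all follow. *)

(** * Finite binary trees and the trajectories of the Yule process *)

Inductive tree := Leaf | Node of tree & tree.

Fixpoint tree_eqb A B := match A, B with
  | Leaf, Leaf => true
  | Node A1 A2, Node B1 B2 => tree_eqb A1 B1 && tree_eqb A2 B2
  | _, _ => false
  end.

Lemma tree_eqbP : Equality.axiom tree_eqb.
Proof.
elim=> [|A1 IH1 A2 IH2] [|B1 B2] /=; try by constructor.
by apply: (iffP andP) => [[/IH1-> /IH2->]|[<- <-]] //; split; [exact/IH1|exact/IH2].
Qed.

HB.instance Definition _ := hasDecEq.Build tree tree_eqbP.

Fixpoint inner A : nat :=
  if A is Node A0 A1 then (inner A0 + inner A1).+1 else 0.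

Fixpoint leaf_words A : seq word :=
  if A is Node A0 A1 then
    map (cons false) (leaf_words A0) ++ map (cons true) (leaf_words A1)
  else [:: [::]].

(** The external path length. *)
Fixpoint path_length A : nat :=
  if A is Node A0 A1 then
    (path_length A0 + path_length A1 + (inner A0).+1 + (inner A1).+1)%N
  else 0.

Lemma size_leaf_words A : size (leaf_words A) = (inner A).+1.
Proof.
elim: A => //= A0 IH0 A1 IH1.
by rewrite size_cat !size_map IH0 IH1 addSn addnS.
Qed.

Lemma sumn_leaf_words A :
  (\sum_(u <- leaf_words A) size u = path_length A)%N.
Proof.
elim: A => /= [|A0 IH0 A1 IH1]; first by rewrite big_seq1.
rewrite big_cat /= !big_map /=.
have E A : (\sum_(j <- leaf_words A) (size j).+1 =
            \sum_(j <- leaf_words A) size j + (inner A).+1)%N.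
  by rewrite -size_leaf_words -sum1_size -big_split /=; apply: eq_bigr => j _; rewrite addn1.
rewrite !E IH0 IH1; lia.
Qed.

Lemma uniq_leaf_words A : uniq (leaf_words A).
Proof.
elim: A => //= A0 IH0 A1 IH1; rewrite cat_uniq !map_inj_uniq ?IH0 ?IH1 ?andbT //=;
  try by move=> x y [].
by apply/hasPn => u /mapP[v _ ->]; apply/mapP => -[].
Qed.

(** When all the clocks are positive, the Yule tree equals [A] exactly during
    the interval from [entry A] to [exit A]: all the internal nodes have split
    and no leaf has.  Describing trees through these two times replaces sets of
    words by an inductive type and makes the events measurable. *)
Section EntryExit.
Variable R : realType.
Implicit Types (e : word -> R) (A B : tree) (t : R).

Definition below (u : word) e : word -> R := fun v => e (u ++ v).

Fixpoint entry A e : R :=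
  if A is Node A0 A1 then
    e [::] + Num.max (entry A0 (below [:: false] e)) (entry A1 (below [:: true] e))
  else 0.

Fixpoint exit A e : R :=
  if A is Node A0 A1 then
    e [::] + Num.min (exit A0 (below [:: false] e)) (exit A1 (below [:: true] e))
  else e [::].

Definition at_time A e t := entry A e <= t < exit A e.

Lemma at_time_Leaf e t : at_time Leaf e t = (0 <= t < e [::]).
Proof. by []. Qed.

Lemma at_time_Node A0 A1 e t : at_time (Node A0 A1) e t =
  at_time A0 (below [:: false] e) (t - e [::]) &&
  at_time A1 (below [:: true] e) (t - e [::]).
Proof.
rewrite /at_time /= -lerBrDl -ltrBlDl ge_max lt_min.
by rewrite -!andbA; congr (_ && _); rewrite andbCA.
Qed.

Lemma entry_ge0 A e : (forall u, 0 <= e u) -> 0 <= entry A e.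
Proof.
elim: A e => //= A0 IH0 A1 IH1 e e0; rewrite addr_ge0 // le_max IH0 // => u.
exact: e0.
Qed.

(** The process only grows, so that it never has two different trees of the same
    size. *)
Lemma at_time_le A B e s t : (forall u, 0 <= e u) -> s <= t ->
  at_time A e s -> at_time B e t ->
  (inner A <= inner B)%N /\ (inner A = inner B -> A = B).
Proof.
elim: A B e s t => [|A0 IH0 A1 IH1] [|B0 B1] e s t e0 st; first by [].
- by split.
- rewrite at_time_Node at_time_Leaf => /andP[/andP[h _] _] /andP[_ te].
  have h' := le_trans (entry_ge0 A0 (fun u => e0 (cat [:: false] u))) h.
  by exfalso; lra.
rewrite !at_time_Node => /andP[a0 a1] /andP[b0 b1].
have st' : s - e [::] <= t - e [::] by rewrite lerD2r.
have [l0 q0] := IH0 _ _ _ _ (fun u => e0 (cat [:: false] u)) st' a0 b0.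
have [l1 q1] := IH1 _ _ _ _ (fun u => e0 (cat [:: true] u)) st' a1 b1.
split=> /=; first by lia.
move=> h; have h0 : inner A0 = inner B0 by lia.
have h1 : inner A1 = inner B1 by lia.
by rewrite (q0 h0) (q1 h1).
Qed.

Lemma at_time_ninner A B e s t : (forall u, 0 <= e u) ->
  at_time A e s -> at_time B e t -> inner A = inner B -> A = B.
Proof.
move=> e0 hA hB hi; have [st|ts] := leP s t.
  by have [_] := at_time_le e0 st hA hB; exact.
by have [_] := at_time_le e0 (ltW ts) hB hA; move=> /(_ (esym hi)).
Qed.

Lemma at_time_inj A B e t : (forall u, 0 <= e u) ->
  at_time A e t -> at_time B e t -> A = B.
Proof.
move=> e0 hA hB; have [leAB eqAB] := at_time_le e0 (lexx t) hA hB.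
have [leBA _] := at_time_le e0 (lexx t) hB hA.
by apply: eqAB; apply/eqP; rewrite eqn_leq leAB.
Qed.

Lemma at_time_before B e t s : (forall u, 0 <= e u) -> at_time B e t ->
  0 <= s <= t -> exists A, at_time A e s.
Proof.
elim: B e t s => [|B0 IH0 B1 IH1] e t s e0.
  move=> /andP[_ te] /andP[s0 st]; exists Leaf.
  by rewrite at_time_Leaf s0 (le_lt_trans st te).
rewrite at_time_Node => /andP[b0 b1] /andP[s0 st].
have [se|es] := ltP s (e [::]); first by exists Leaf; rewrite at_time_Leaf s0.
have h : 0 <= s - e [::] <= t - e [::] by rewrite subr_ge0 es lerD2r.
have [A0 a0] := IH0 _ _ _ (fun u => e0 (cat [:: false] u)) b0 h.
have [A1 a1] := IH1 _ _ _ (fun u => e0 (cat [:: true] u)) b1 h.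
by exists (Node A0 A1); rewrite at_time_Node a0.
Qed.

Lemma birth_nil e : birth e [::] = 0.
Proof. by rewrite /birth big_ord0. Qed.

Lemma birth_cons e i v : birth e (i :: v) = e [::] + birth (below [:: i] e) v.
Proof.
by rewrite /birth /= big_ord_recl /=; congr (_ + _); apply: eq_bigr.
Qed.

Lemma yule_cons e t i v : yule e t (i :: v) = yule (below [:: i] e) (t - e [::]) v.
Proof. by rewrite /yule /= birth_cons -lerBrDl. Qed.

(** The bridge between the sets of words of the statement and the trees. *)
Lemma leaves_yule A e t : (forall u, 0 <= e u) -> at_time A e t ->
  leaves (yule e t) = [set` leaf_words A].
Proof.
elim: A e t => [|A0 IH0 A1 IH1] e t e0.
  rewrite at_time_Leaf => /andP[t0 te].
  have out i v : ~ yule e t (i :: v).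
    rewrite /yule /= birth_cons; apply/negP; rewrite -ltNge (lt_le_trans te) //.
    by rewrite lerDl sumr_ge0 // => k _; exact: e0.
  apply/seteqP; split=> [[|i v] [h _]|u] /=.
  - by rewrite inE.
  - by have := out _ _ h.
  - rewrite inE => /eqP ->; split; first by rewrite /yule /= birth_nil.
    by case=> // i v _; exact: out.
rewrite at_time_Node => /andP[a0 a1].
have te : e [::] <= t.
  have := entry_ge0 A0 (fun u => e0 (cat [:: false] u)).
  by move: a0 => /andP[/(le_trans _) h _] /h; rewrite subr_ge0.
have leafE i v : leaves (yule e t) (i :: v) <->
    leaves (yule (below [:: i] e) (t - e [::])) v.
  by rewrite /leaves /= yule_cons; split=> -[h1 h2]; split=> // w w0;
    have := h2 _ w0; rewrite yule_cons.
have e0' i u : 0 <= below [:: i] e u by exact: e0.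
apply/seteqP; split=> [[|i v]|u] /=.
- move=> [_ /(_ [:: false] isT)] h; exfalso; apply: h.
  by rewrite /yule /= birth_cons birth_nil addr0.
- move/leafE; case: i.
    by rewrite IH1 //= mem_cat => h; rewrite map_f ?orbT.
  by rewrite IH0 //= mem_cat => h; rewrite map_f.
- rewrite mem_cat => /orP[] /mapP[v hv ->]; apply/leafE.
    by rewrite (IH0 _ _ (e0' _) a0).
  by rewrite (IH1 _ _ (e0' _) a1).
Qed.

Lemma leaf_fset_yule A e t : (forall u, 0 <= e u) -> at_time A e t ->
  perm_eq (leaf_fset (yule e t)) (leaf_words A).
Proof.
move=> e0 h; rewrite /leaf_fset (leaves_yule e0 h).
apply: uniq_perm; [exact: fset_uniq|exact: uniq_leaf_words|] => u.
rewrite in_fset_set; last by exact: finite_seq.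
by apply/idP/idP; rewrite inE.
Qed.

Lemma nleaves_yule A e t : (forall u, 0 <= e u) -> at_time A e t ->
  nleaves (yule e t) = (inner A).+1.
Proof.
by move=> e0 h; rewrite /nleaves (perm_size (leaf_fset_yule e0 h)) size_leaf_words.
Qed.

End EntryExit.

(** * The binary trees of a given size and their weights *)

(** The first argument is fuel; any value that is at least the size will do. *)
Fixpoint trees_rec (k n : nat) : seq tree :=
  match k, n with
  | _, 0 => [:: Leaf]
  | 0, _ => [::]
  | k'.+1, n'.+1 =>
    [seq Node A.1 A.2 | i <- iota 0 n'.+1,
       A <- [seq (A0, A1) | A0 <- trees_rec k' i, A1 <- trees_rec k' (n' - i)]]
  end.

Definition trees n := trees_rec n n.

Lemma trees_recS k n : trees_rec k.+1 n.+1 =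
  flatten [seq [seq Node A.1 A.2 |
       A <- [seq (A0, A1) | A0 <- trees_rec k i, A1 <- trees_rec k (n - i)]]
  | i <- iota 0 n.+1].
Proof. by []. Qed.

Lemma trees_rec_fuel k n : (n <= k)%N -> trees_rec k n = trees n.
Proof.
suff H k1 k2 : (n <= k1)%N -> (n <= k2)%N -> trees_rec k1 n = trees_rec k2 n.
  by move=> h; exact: H.
elim: k1 k2 n {k} => [|k1 IH] [|k2] [|n] // h1 h2; rewrite !trees_recS.
congr flatten; apply/eq_in_map => i; rewrite mem_iota => hi.
by rewrite (IH k2 i) ?(IH k2 (n - i)%N) //; lia.
Qed.

Lemma treesS n : trees n.+1 =
  [seq Node A.1 A.2 | i <- iota 0 n.+1,
     A <- [seq (A0, A1) | A0 <- trees i, A1 <- trees (n - i)]].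
Proof.
rewrite {1}/trees trees_recS; congr flatten.
apply/eq_in_map => i; rewrite mem_iota => hi.
by rewrite !trees_rec_fuel //; lia.
Qed.

Lemma mem_trees A n : (A \in trees n) = (inner A == n).
Proof.
elim/ltn_ind: n A => -[|n] IH A; first by case: A.
rewrite treesS; apply/allpairsPdep/idP => [[i [[A0 A1]]]|].
  move=> [hi /allpairsP[[B0 B1] [/= h0 h1 [-> ->]]] ->] /=.
  have {}hi : (i < n.+1)%N by rewrite -[(i < n.+1)%N]/(0 <= i < 0 + n.+1)%N -mem_iota.
  by move: h0 h1; rewrite !IH; lia.
case: A => // A0 A1 /= hA; exists (inner A0), (A0, A1); split => //.
- by rewrite -[_ :: _]/(iota 0 n.+1) mem_iota; lia.
- by apply/allpairsP; exists (A0, A1); split; rewrite /= ?IH; try exact: erefl; lia.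
Qed.

Lemma uniq_trees n : uniq (trees n).
Proof.
elim/ltn_ind: n => -[//|n] IH.
rewrite treesS; apply: allpairs_uniq_dep; first exact: iota_uniq.
  move=> i; rewrite mem_iota => hi.
  by apply: allpairs_uniq; rewrite ?IH //; try lia; move=> [x1 x2] [y1 y2] _ _ [-> ->].
have inner_tag (i : nat) (A : tree * tree) :
    A \in [seq (A0, A1) | A0 <- trees i, A1 <- trees (n - i)] -> i = inner A.1.
  by move=> /allpairsP[[B0 B1] [/= h0 _ ->]]; move: h0; rewrite mem_trees => /eqP ->.
move=> x y /allpairsPdep[i [A [_ /inner_tag hi ->]]].
move=> /allpairsPdep[j [B [_ /inner_tag hj ->]]] /= [e0 e1].
have AB : A = B by case: A B e0 e1 {hi hj} => [? ?] [? ?] /= -> ->.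
by rewrite hi hj AB.
Qed.

Lemma big_trees_rec (V : nmodType) (F : tree -> V) n :
  \sum_(A <- trees n.+1) F A =
  \sum_(i < n.+1) \sum_(A0 <- trees i) \sum_(A1 <- trees (n - i)) F (Node A0 A1).
Proof.
rewrite treesS big_allpairs_dep /= -[_ :: _]/(iota 0 n.+1).
rewrite -[iota 0 n.+1]/(index_iota 0 n.+1) big_mkord.
by apply: eq_bigr => i _; rewrite big_allpairs.
Qed.

Section Weight.
Variable R : realType.
Implicit Types (A B : tree).

(** The probability that the binary search tree on [inner A] keys is [A]: the
    root key is uniform and the two subtrees are independent. *)
Fixpoint weight A : R :=
  if A is Node A0 A1 then weight A0 * weight A1 / (inner A0 + inner A1).+1%:R
  else 1.

Lemma weight_ge0 A : 0 <= weight A.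
Proof. by elim: A => //= A0 h0 A1 h1; rewrite mulr_ge0 ?mulr_ge0 ?invr_ge0. Qed.

Definition bst_mean n (F : tree -> R) := \sum_(A <- trees n) weight A * F A.

(** The recursive structure of the random binary search tree: the size of the
    left subtree is uniform. *)
Lemma bst_meanS n (F : tree -> R) : bst_mean n.+1 F =
  n.+1%:R^-1 * \sum_(i < n.+1)
    bst_mean i (fun A0 => bst_mean (n - i) (fun A1 => F (Node A0 A1))).
Proof.
rewrite /bst_mean big_trees_rec mulr_sumr; apply: eq_bigr => i _.
rewrite mulr_sumr big_seq [RHS]big_seq; apply: eq_bigr => A0; rewrite mem_trees => /eqP h0.
rewrite !mulr_sumr big_seq [RHS]big_seq; apply: eq_bigr => A1; rewrite mem_trees => /eqP h1.
rewrite /= h0 h1 subnKC; last by rewrite -ltnS.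
ring.
Qed.

Lemma bst_mean_const n c : bst_mean n (fun=> c) = c.
Proof.
elim/ltn_ind: n => -[|n] IH; first by rewrite /bst_mean big_seq1 mul1r.
rewrite bst_meanS (eq_bigr (fun=> c)); last first.
  move=> i _; rewrite -[RHS](IH i) //; congr bst_mean.
  by apply: funext => A0; apply: IH; lia.
by rewrite big_const_ord iter_addr_0 -[c *+ _]mulr_natl mulrA mulVf ?mul1r.
Qed.

Lemma sum_weight n : \sum_(A <- trees n) weight A = 1.
Proof.
by rewrite -[RHS](bst_mean_const n); apply: eq_bigr => A _; rewrite mulr1.
Qed.

End Weight.

(** * Riemann sums along a geometric subdivision *)

Section PowerSums.
Variable R : realType.
Implicit Types (x y q a : R).

Lemma power_diff_le n x y : 0 <= y <= x ->
  n.+1%:R * y ^+ n * (x - y) <= x ^+ n.+1 - y ^+ n.+1 <= n.+1%:R * x ^+ n * (x - y).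
Proof.
move=> /andP[y0 yx]; have x0 := le_trans y0 yx.
have d0 : 0 <= x - y by rewrite subr_ge0.
rewrite subrXX ![_ * (x - y)]mulrC.
have cst c : n.+1%:R * c = \sum_(i < n.+1) c :> R.
  by rewrite big_const_ord iter_addr_0 mulr_natl.
apply/andP; split; rewrite ler_wpM2l // cst ler_sum // => i _.
  rewrite -{1}(@subnK i n) -1?ltnS // exprD ler_wpM2r ?exprn_ge0 //=.
  by rewrite lerXn2r ?nnegrE.
rewrite -[in leRHS](@subnK i n) -1?ltnS // exprD ler_wpM2l ?exprn_ge0 //.
by rewrite lerXn2r ?nnegrE.
Qed.

(** Both sums below are Riemann sums of [v |-> (a - v) ^ N] over the geometric
    subdivision [q ^ j] of [1, a = q ^ m], up to powers of the ratio [q]. *)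
Lemma geometric_sum_le q m N : 1 <= q ->
  \sum_(j < m) (q ^- j - q ^- j.+1) * ((q ^+ j.+1) ^+ N.+2 * (q ^+ m / q ^+ j - 1) ^+ N)
    <= q ^+ N.+2 * (q ^+ m - q^-1) ^+ N.+1 / N.+1%:R.
Proof.
move=> q1; set a := q ^+ m; have q0 : 0 < q by exact: lt_le_trans q1.
have qj0 j : 0 < q ^+ j by rewrite exprn_gt0.
have qN0 : q != 0 by rewrite gt_eqF.
suff H k : (k <= m)%N ->
  \sum_(j < k) (q ^- j - q ^- j.+1) * ((q ^+ j.+1) ^+ N.+2 * (a / q ^+ j - 1) ^+ N)
    <= q ^+ N.+2 / N.+1%:R * ((a - q^-1) ^+ N.+1 - (a - q ^+ k / q) ^+ N.+1).
  apply: le_trans (H m (leqnn m)) _.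
  rewrite [leRHS]mulrAC ler_wpM2l ?divr_ge0 ?exprn_ge0 ?(ltW q0) //.
  rewrite gerBl exprn_ge0 // subr_ge0 ler_pdivrMr //.
  by rewrite ler_peMr // ltW.
elim: k => [|k IH] km.
  by rewrite big_ord0 expr0 mul1r subrr mulr0.
rewrite big_ord_recr /=; apply: le_trans (lerD (IH (ltnW km)) (lexx _)) _.
set X := (a - q^-1) ^+ N.+1; set Y := (a - _) ^+ N.+1; set Z := (a - _ / q) ^+ N.+1.
have ka : q ^+ k <= a by rewrite ler_weXn2l // ltnW.
have term : (q ^- k - q ^- k.+1) * ((q ^+ k.+1) ^+ N.+2 * (a / q ^+ k - 1) ^+ N)
   = q ^+ N.+2 * ((a - q ^+ k) ^+ N * (q ^+ k - q ^+ k / q)).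
  have -> : a / q ^+ k - 1 = (a - q ^+ k) / q ^+ k by field; rewrite gt_eqF.
  rewrite expr_div_n [q ^+ k.+1]exprS exprMn 2!(exprSr (q ^+ k)).
  by field; rewrite !gt_eqF // exprn_gt0.
have le1 : 0 <= a - q ^+ k <= a - q ^+ k / q.
  by rewrite subr_ge0 ka lerB // ler_pdivrMr // ler_peMr // ltW.
have /andP[+ _] := power_diff_le N le1.
rewrite (_ : a - q ^+ k / q - (a - q ^+ k) = q ^+ k - q ^+ k / q); last by ring.
rewrite -/Y (_ : (a - q ^+ k) ^+ N.+1 = Z); last first.
  by rewrite /Z [q ^+ k.+1]exprSr mulfK.
move=> h; rewrite term.
have N0 : (0 : R) < N.+1%:R by rewrite ltr0n.
have -> : q ^+ N.+2 / N.+1%:R * (X - Z) =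
   q ^+ N.+2 / N.+1%:R * (X - Y) + q ^+ N.+2 * ((Y - Z) / N.+1%:R).
  by field; rewrite gt_eqF.
rewrite lerD2l ler_wpM2l ?exprn_ge0 ?(ltW q0) // ler_pdivlMr //.
by apply: le_trans _ h; rewrite [leLHS]mulrC mulrA.
Qed.

Lemma geometric_sum_ge q m N : 1 <= q -> (0 < m)%N ->
  q ^- N.+2 * (q ^+ m - q) ^+ N.+1 / N.+1%:R <=
  \sum_(j < m) (q ^- j - q ^- j.+1) * ((q ^+ j) ^+ N.+2 * (q ^+ m / q ^+ j.+1 - 1) ^+ N).
Proof.
case: m => [|m] q1 // _; set a := q ^+ m.+1; have q0 : 0 < q by exact: lt_le_trans q1.
have qj0 j : 0 < q ^+ j by rewrite exprn_gt0.
have qN0 : q != 0 by rewrite gt_eqF.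
have N0 : (0 : R) < N.+1%:R by rewrite ltr0n.
have term j : (q ^- j - q ^- j.+1) * ((q ^+ j) ^+ N.+2 * (a / q ^+ j.+1 - 1) ^+ N)
   = q ^- N.+2 * ((a - q ^+ j.+1) ^+ N * (q ^+ j.+2 - q ^+ j.+1)).
  have -> : a / q ^+ j.+1 - 1 = (a - q ^+ j.+1) / q ^+ j.+1 by field; rewrite gt_eqF.
  rewrite expr_div_n [q ^+ j.+2]exprS [q ^+ j.+1]exprS exprMn 2!(exprSr (q ^+ j)) 2!(exprSr q).
  by field; rewrite !gt_eqF // exprn_gt0.
suff H k : (k <= m)%N -> q ^- N.+2 / N.+1%:R * ((a - q) ^+ N.+1 - (a - q ^+ k.+1) ^+ N.+1) <=
  \sum_(j < k) (q ^- j - q ^- j.+1) * ((q ^+ j) ^+ N.+2 * (a / q ^+ j.+1 - 1) ^+ N).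
  rewrite big_ord_recr /= term /a subrr.
  apply: le_trans (_ : _ <= q ^- N.+2 / N.+1%:R * ((a - q) ^+ N.+1 - (a - q ^+ m.+1) ^+ N.+1)) _.
    by rewrite /a subrr expr0n subr0 mulrAC.
  apply: le_trans (H m (leqnn m)) _; rewrite lerDl.
  rewrite mulr_ge0 ?invr_ge0 ?exprn_ge0 ?(ltW q0) // mulr_ge0 // ?exprn_ge0 //.
  by rewrite subr_ge0 ler_weXn2l.
elim: k => [|k IH] km.
  by rewrite big_ord0 expr1 subrr mulr0.
rewrite big_ord_recr /=; apply: le_trans (lerD (IH (ltnW km)) (lexx _)).
set X := (a - q) ^+ N.+1; set Y := (a - q ^+ k.+1) ^+ N.+1; set Z := (a - _) ^+ N.+1.
have ka : q ^+ k.+2 <= a by rewrite ler_weXn2l.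
rewrite term.
have le1 : 0 <= a - q ^+ k.+2 <= a - q ^+ k.+1.
  by rewrite subr_ge0 ka lerB // ler_weXn2l.
have /andP[_ +] := power_diff_le N le1.
rewrite (_ : a - q ^+ k.+1 - (a - q ^+ k.+2) = q ^+ k.+2 - q ^+ k.+1); last by ring.
rewrite -/Y -/Z => h.
have -> : q ^- N.+2 / N.+1%:R * (X - Z) =
   q ^- N.+2 / N.+1%:R * (X - Y) + q ^- N.+2 * ((Y - Z) / N.+1%:R).
  by field; rewrite !gt_eqF // exprn_gt0.
rewrite lerD2l ler_wpM2l ?invr_ge0 ?exprn_ge0 ?(ltW q0) // ler_pdivrMr //.
by apply: le_trans h _; rewrite [leRHS]mulrC mulrA.
Qed.

End PowerSums.

(** * Independent exponential clocks *)

Lemma bigsetU_seqP (T : Type) (I : eqType) (s : seq I) (F : I -> set T) x :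
  (\big[setU/set0]_(i <- s) F i) x <-> exists2 i, i \in s & F i x.
Proof.
elim: s => [|i s IH]; first by rewrite big_nil; split=> [//|[]].
rewrite big_cons; split=> [[Fi|/IH[j js Fj]]|[j]].
- by exists i; rewrite ?mem_head.
- by exists j; rewrite // inE js orbT.
- by rewrite inE => /predU1P[->|js] Fj; [left|right; apply/IH; exists j].
Qed.

Section RealProbability.
Context d (Omega : measurableType d) (R : realType) (P : probability Omega R).
Implicit Types A B C : set Omega.

Definition prob A : R := fine (P A).
Local Notation pr := prob.

Lemma probE A : measurable A -> P A = (pr A)%:E.
Proof. by move=> mA; rewrite /prob fineK // fin_num_measure. Qed.

Lemma prob_ge0 A : 0 <= pr A.
Proof. by rewrite fine_ge0. Qed.

Lemma prob_le A B : measurable A -> measurable B -> A `<=` B -> pr A <= pr B.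
Proof.
by move=> mA mB AB; rewrite -lee_fin -!probE // le_measure // inE.
Qed.

Lemma probT : pr setT = 1.
Proof. by rewrite /prob probability_setT. Qed.

Lemma prob0 : pr set0 = 0.
Proof. by rewrite /prob measure0. Qed.

Lemma prob_le1 A : measurable A -> pr A <= 1.
Proof. by move=> mA; rewrite -probT prob_le. Qed.

Lemma probU A B : measurable A -> measurable B -> A `&` B = set0 ->
  pr (A `|` B) = pr A + pr B.
Proof.
move=> mA mB AB; apply: EFin_inj; rewrite EFinD -!probE //; last exact: measurableU.
by rewrite measureU.
Qed.

Lemma probC A : measurable A -> pr (~` A) = 1 - pr A.
Proof.
move=> mA; apply: EFin_inj; rewrite -probE; last exact: measurableC.
by rewrite probability_setC // probE.
Qed.

Lemma probD A B : measurable A -> measurable B -> B `<=` A ->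
  pr (A `\` B) = pr A - pr B.
Proof.
move=> mA mB BA; rewrite -[in RHS](setDUK BA) probU //; first by rewrite addrAC subrr add0r.
  exact: measurableD.
by rewrite setDE setICA setICr setI0.
Qed.

Lemma sum_prob_le (I : eqType) (s : seq I) (F : I -> set Omega) C : uniq s ->
  (forall i, measurable (F i)) -> measurable C ->
  (forall i, F i `<=` C) ->
  (forall i j w, F i w -> F j w -> i = j) ->
  \sum_(i <- s) pr (F i) <= pr C.
Proof.
move=> us mF mC FC disj.
apply: (@le_trans _ _ (pr (\big[setU/set0]_(i <- s) F i))); last first.
  apply: prob_le => //; first by apply: bigsetU_measurable.
  by move=> w /bigsetU_seqP[i _]; exact: FC.
elim: s us => [|i s IH] /=; first by rewrite !big_nil prob0.
move=> /andP[si us]; rewrite !big_cons probU //.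
- by rewrite lerD2l IH.
- by apply: bigsetU_measurable.
- apply/seteqP; split=> // w [Fi /bigsetU_seqP[j js Fj]]; move: si.
  by rewrite (disj _ _ _ Fi Fj) js.
Qed.

Lemma prob_le_sum (I : Type) (s : seq I) (F : I -> set Omega) C :
  (forall i, measurable (F i)) -> measurable C ->
  C `<=` \big[setU/set0]_(i <- s) F i ->
  pr C <= \sum_(i <- s) pr (F i).
Proof.
move=> mF mC h; have mU s' : measurable (\big[setU/set0]_(i <- s') F i).
  by apply: bigsetU_measurable.
apply: le_trans (prob_le mC (mU s) h) _.
elim: s {h} => [|i s IH]; first by rewrite !big_nil prob0.
rewrite !big_cons; apply: le_trans (lerD (lexx _) IH).
rewrite -lee_fin EFinD -!probE //; last by exact: measurableU.
exact: measureU2.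
Qed.

End RealProbability.
Arguments prob {d Omega R} P A.

Section Clocks.
Context d (Omega : measurableType d) (R : realType) (P : probability Omega R).
Variable E : word -> {RV P >-> R}.
Hypothesis Elaw : forall u, has_law P (E u) (exponential_prob (1 : R)).
Hypothesis Eind : mutually_independent P E.
Local Notation pr := (prob P).

Definition clocks w : word -> R := fun u => E u w.

Lemma measurable_clock u (A : set R) : measurable A -> measurable (E u @^-1` A).
Proof. by move=> mA; rewrite -[X in measurable X]setTI; exact: measurable_funP. Qed.
Hint Resolve measurable_clock : core.

Lemma prob_clock_itv u x : 0 < x -> pr (E u @^-1` `[0, x]) = 1 - expR (- x).
Proof.
move=> x0; rewrite /prob Elaw // exponential_prob_itv0c //.
by rewrite mulN1r.
Qed.

Lemma cvg_expR_inv : expR (- (n.+1%:R^-1 : R)) @[n --> \oo] --> (1 : R).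
Proof.
rewrite -[X in _ --> X]expR0; apply: continuous_cvg; first exact: continuous_expR.
by rewrite -oppr0; apply: cvgN; exact: cvg_harmonic.
Qed.

(** The nonpositive half-line is covered by the complement of the segment
    [0, n + 1] and by the segment [0, 1 / (n + 1)], whose probabilities tend
    to 0. *)
Lemma prob_clock_le0 u : pr (E u @^-1` `]-oo, 0]) = 0.
Proof.
apply/eqP; rewrite eq_le prob_ge0 andbT.
have key n : pr (E u @^-1` `]-oo, 0]) <= expR (- n.+1%:R) + (1 - expR (- n.+1%:R^-1)).
  have n0 : (0 : R) < n.+1%:R by rewrite ltr0n.
  have := probC P (measurable_clock u (measurable_itv `[0, n.+1%:R])).
  rewrite prob_clock_itv // opprB addrCA subrr addr0 => <-.
  rewrite -(prob_clock_itv u) ?invr_gt0 //.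
  have := @prob_le_sum _ _ _ P bool [:: true; false]
    (fun b => if b then ~` (E u @^-1` `[0, n.+1%:R]) else E u @^-1` `[0, n.+1%:R^-1])
    (E u @^-1` `]-oo, 0]).
  rewrite !big_cons !big_nil addr0; apply.
  - by case; [apply: measurableC|]; exact: measurable_clock.
  - exact: measurable_clock.
  - rewrite setU0 => w /=; rewrite !in_itv /= => h.
    have [h0|h0] := leP 0 (E u w).
      by right; rewrite (le_trans h) // invr_ge0.
    by left; rewrite ltNge in h0; move/negP: h0 => h0 /andP[].
apply: (@ler_cvg_to nat \oo _ R (fun=> pr (E u @^-1` `]-oo, 0]))
  (fun n => expR (- n.+1%:R) + (1 - expR (- n.+1%:R^-1)))); last exact: nearW.
  exact: cvg_cst.
rewrite -[X in _ --> X]addr0; apply: cvgD.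
  by have := @cvgn_expR R; rewrite -cvg_shiftS.
rewrite -(subrr 1); apply: cvgB; first exact: cvg_cst.
exact: cvg_expR_inv.
Qed.

Lemma prob_clock_le u x : 0 <= x -> pr (E u @^-1` `]-oo, x]) = 1 - expR (- x).
Proof.
rewrite le_eqVlt => /predU1P[<-|x0]; first by rewrite prob_clock_le0 oppr0 expR0 subrr.
have -> : E u @^-1` `]-oo, x] = E u @^-1` `]-oo, 0[ `|` E u @^-1` `[0, x].
  rewrite -preimage_setU; congr (_ @^-1` _); apply/seteqP.
  split=> y /=; rewrite !in_itv /=.
    by case: (ltP y 0) => h ->; [left|right].
  by case=> [h|/andP[]//]; rewrite ltW // (lt_trans h).
rewrite probU //; [|exact: measurable_clock|exact: measurable_clock|]; last first.
  apply/seteqP; split=> // w [] /=; rewrite !in_itv /= => h /andP[h' _].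
  by have := lt_le_trans h h'; rewrite ltxx.
rewrite prob_clock_itv // (_ : pr _ = 0) ?add0r //.
apply/eqP; rewrite eq_le prob_ge0 andbT.
apply: le_trans (_ : _ <= pr (E u @^-1` `]-oo, 0])) _; last by rewrite prob_clock_le0.
by apply: prob_le; [exact: measurable_clock..|] => w /=; rewrite !in_itv /=; exact: ltW.
Qed.

Lemma prob_clock_oc u a b : 0 <= a <= b ->
  pr (E u @^-1` `]a, b]) = expR (- a) - expR (- b).
Proof.
move=> /andP[a0 ab].
have -> : E u @^-1` `]a, b] = E u @^-1` `]-oo, b] `\` E u @^-1` `]-oo, a].
  rewrite -[RHS]/(E u @^-1` (`]-oo, b] `\` `]-oo, a])).
  congr (_ @^-1` _); apply/seteqP; split=> y /=; rewrite !in_itv /=.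
    by move=> /andP[h ->]; split=> //; apply/negP; rewrite -ltNge.
  by move=> [-> /negP]; rewrite -ltNge => ->.
rewrite probD; try exact: measurable_clock.
  by rewrite !prob_clock_le // ?(le_trans a0) // opprB addrC addrA addrNK addrC.
by move=> w /=; rewrite !in_itv /= => /le_trans; apply.
Qed.

Lemma prob_clock_gt u t : 0 <= t -> pr (E u @^-1` `]t, +oo[) = expR (- t).
Proof.
move=> t0; have -> : E u @^-1` `]t, +oo[ = ~` (E u @^-1` `]-oo, t]).
  rewrite -[RHS]/(E u @^-1` (~` `]-oo, t])).
  congr (_ @^-1` _); apply/seteqP; split=> y /=; rewrite !in_itv /= ?andbT.
    by move=> h; apply/negP; rewrite -ltNge.
  by move=> /negP; rewrite -ltNge.
rewrite probC; last exact: measurable_clock.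
by rewrite prob_clock_le // opprB addrCA subrr addr0.
Qed.

Definition cylinder (s : seq word) (A : word -> set R) : set Omega :=
  [set w | forall u, u \in s -> A u (E u w)].

Lemma measurable_cylinder s A : (forall u, measurable (A u)) -> measurable (cylinder s A).
Proof.
move=> mA; have -> : cylinder s A = \big[setI/setT]_(u <- s) (E u @^-1` A u).
  rewrite -bigcap_seq; apply/seteqP; split => w /=; first by move=> h u; exact: h.
  by move=> h u; exact: h.
by apply: bigsetI_measurable => u _; exact: measurable_clock.
Qed.

(** The labels [S] shrink as clocks are used: by [indep_cylinder], an event built
    from [B] and from clocks of [S] is still independent of the rest of [S]. *)
Definition indep (S : pred word) (B : set Omega) : Prop :=
  measurable B /\
  forall s (A : word -> set R), uniq s -> all S s -> (forall u, measurable (A u)) ->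
    pr (B `&` cylinder s A) = pr B * \prod_(u <- s) pr (E u @^-1` A u).

Lemma indepT : indep predT setT.
Proof.
split=> // s A us _ mA; rewrite setTI probT mul1r.
have -> : cylinder s A = \bigcap_(u in [set` s]) (E u @^-1` A u) by [].
rewrite /prob Eind // (eq_bigr (fun u => (pr (E u @^-1` A u))%:E)).
  by rewrite prodEFin.
by move=> u _; rewrite -probE //; exact: measurable_clock.
Qed.

Lemma indep_cylinder (S S' : pred word) B s A : indep S B -> uniq s -> all S s ->
  (forall u, measurable (A u)) -> subpred S' S ->
  (forall u, S' u -> u \notin s) -> indep S' (B `&` cylinder s A).
Proof.
move=> [mB iB] us Ss mA S'S disj; split.
  by apply: measurableI => //; exact: measurable_cylinder.
move=> s' A' us' Ss' mA'.
have dis u : u \in s' -> u \notin s by move/(allP Ss'); exact: disj.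
pose A'' u := if u \in s then A u else A' u.
have mA'' u : measurable (A'' u) by rewrite /A''; case: ifP.
have -> : B `&` cylinder s A `&` cylinder s' A' = B `&` cylinder (s ++ s') A''.
  rewrite -setIA; congr (_ `&` _); apply/seteqP; split=> w /=.
    move=> [h h'] u; rewrite mem_cat /A''; case: ifP => [us0 _|_ /= us0]; [exact: h|exact: h'].
  move=> h; split=> u hu; have := h u; rewrite mem_cat hu ?orbT /A'' => /(_ isT).
    by rewrite hu.
  by rewrite (negbTE (dis _ hu)).
rewrite iB //; last 2 first.
- rewrite cat_uniq us us' andbT; apply/hasPn => u; exact: dis.
- by rewrite all_cat Ss; apply: sub_all Ss'.
rewrite big_cat /= mulrA; congr (_ * _).
  rewrite iB //; congr (_ * _).
  by apply: eq_big_seq => u hu; rewrite /A'' hu.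
apply: eq_big_seq => u hu.
by rewrite /A'' (negbTE (dis _ hu)).
Qed.

Lemma indep_clock (S S' : pred word) B u (I : set R) : indep S B -> S u ->
  measurable I -> subpred S' S -> ~~ S' u ->
  indep S' (B `&` E u @^-1` I) /\ pr (B `&` E u @^-1` I) = pr B * pr (E u @^-1` I).
Proof.
move=> iB Su mI S'S S'u.
have E1 : E u @^-1` I = cylinder [:: u] (fun=> I).
  by apply/seteqP; split=> w /= => [h v|]; [rewrite inE => /eqP ->|apply; rewrite inE].
split; rewrite E1.
  apply: (@indep_cylinder S) => //=; first by rewrite Su.
  by move=> v S'v; rewrite inE; apply: contra S'u => /eqP <-.
by case: iB => mB ->; rewrite //= ?Su // big_seq1 -E1.
Qed.

End Clocks.

(** * The law of the Yule tree during a time window *)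

Lemma below_below (R : realType) (u v : word) (e : word -> R) :
  below v (below u e) = below (u ++ v) e.
Proof. by apply: funext => x; rewrite /below catA. Qed.

Section Window.
Context d (Omega : measurableType d) (R : realType) (P : probability Omega R).
Variable E : word -> {RV P >-> R}.
Hypothesis Elaw : forall u, has_law P (E u) (exponential_prob (1 : R)).
Hypothesis Eind : mutually_independent P E.
Local Notation pr := (prob P).

Definition positive_clocks : set Omega := [set w | forall u, 0 < E u w].

Lemma ae_positive_clocks : {ae P, forall w, positive_clocks w}.
Proof.
have H (n : nat) : {ae P, forall w,
    if (choice.unpickle n : option word) is Some u then 0 < E u w else true}.
  case: (choice.unpickle n : option word) => [u|]; last exact: aeW.
  have := prob_clock_le0 Elaw u.
  move=> h; exists (E u @^-1` `]-oo, 0]); split.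
  - exact: measurable_clock.
  - by rewrite probE ?h //; exact: measurable_clock.
  - by move=> w /= /negP; rewrite -leNgt in_itv.
have /ae_foralln := H; apply: filterS => w h u.
by have := h (choice.pickle u); rewrite choice.pickleK.
Qed.

Lemma measurable_positive_clocks : measurable positive_clocks.
Proof.
pose G (o : option word) := if o is Some u then E u @^-1` `]0, +oo[ else setT.
have -> : positive_clocks = \bigcap_(n : nat) G (choice.unpickle n).
  apply/seteqP; split=> w h.
    move=> n _; case: (choice.unpickle n) => [u|//].
    by rewrite /G /= in_itv /= andbT.
  by move=> u; have := h (choice.pickle u) I; rewrite choice.pickleK /= in_itv /= andbT.
apply: bigcap_measurableType => n _; case: (choice.unpickle n) => [u|]; rewrite /G.
  exact: measurable_clock.
exact: measurableT.
Qed.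

Lemma prob_positive_clocks : pr (~` positive_clocks) = 0.
Proof.
rewrite /prob (_ : P _ = 0%E) //; apply/negligibleP.
  by apply: measurableC; exact: measurable_positive_clocks.
exact: ae_positive_clocks.
Qed.

Lemma measurable_entry A (e : Omega -> word -> R) :
  (forall u, measurable_fun setT (fun w => e w u)) ->
  measurable_fun setT (fun w => entry A (e w)).
Proof.
elim: A e => [|A0 IH0 A1 IH1] e me /=; first exact: measurable_cst.
apply: measurable_funD; first exact: me.
by apply: measurable_maxr; [apply: IH0|apply: IH1] => u; exact: me.
Qed.

Lemma measurable_exit A (e : Omega -> word -> R) :
  (forall u, measurable_fun setT (fun w => e w u)) ->
  measurable_fun setT (fun w => exit A (e w)).
Proof.
elim: A e => [|A0 IH0 A1 IH1] e me /=; first exact: me.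
apply: measurable_funD; first exact: me.
by apply: measurable_minr; [apply: IH0|apply: IH1] => u; exact: me.
Qed.

Definition window u A (t t' : R) : set Omega :=
  [set w | entry A (below u (clocks E w)) <= t /\ t' < exit A (below u (clocks E w))].

Lemma measurable_window u A t t' : measurable (window u A t t').
Proof.
have -> : window u A t t' =
    (fun w => entry A (below u (clocks E w))) @^-1` `]-oo, t] `&`
    (fun w => exit A (below u (clocks E w))) @^-1` `]t', +oo[.
  by apply/seteqP; split=> w; rewrite /= !in_itv /= andbT.
apply: measurableI; rewrite -[X in measurable X]setTI.
  by apply: measurable_entry => // v; exact: measurable_funP.
by apply: measurable_exit => // v; exact: measurable_funP.
Qed.

Lemma window_Leaf u t t' : 0 <= t -> window u Leaf t t' = E u @^-1` `]t', +oo[.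
Proof.
move=> t0; apply/seteqP; split=> w; rewrite /window /= in_itv /= andbT /below cats0.
  by case.
by split.
Qed.

Definition children u A0 A1 t t' :=
  window (u ++ [:: false]) A0 t t' `&` window (u ++ [:: true]) A1 t t'.

Lemma window_NodeE u A0 A1 t t' w : window u (Node A0 A1) t t' w <->
  children u A0 A1 (t - E u w) (t' - E u w) w.
Proof.
have e0 : below u (clocks E w) [::] = E u w by rewrite /below cats0.
rewrite /window /children /window /= !below_below e0.
rewrite -lerBrDl ge_max -ltrBlDl lt_min; split.
  by case=> /andP[-> ->] /andP[-> ->].
by move=> [[-> ->] [-> ->]].
Qed.

Lemma children_mono u A0 A1 s s' t t' : s <= t -> t' <= s' ->
  children u A0 A1 s s' `<=` children u A0 A1 t t'.
Proof.
move=> st ts w [[h0 k0] [h1 k1]]; split; split.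
- exact: le_trans h0 st.
- exact: le_lt_trans k0.
- exact: le_trans h1 st.
- exact: le_lt_trans k1.
Qed.

Lemma measurable_children u A0 A1 t t' : measurable (children u A0 A1 t t').
Proof. by apply: measurableI; exact: measurable_window. Qed.

(** The probability [weight A * e ^ (- t) * (1 - e ^ (- t)) ^ n] that the tree is
    [A] at time [t], times the probability that none of its [n + 1] leaves
    splits before [t'], rearranged to separate [t] from [t']. *)
Definition window_prob A (t t' : R) : R :=
  weight R A * expR (- t') ^+ (inner A).+1 * (expR t - 1) ^+ inner A.

(** Tensoring with [B] makes the statement suitable for an induction on [A]: in
    the induction step [B] records the clock at the root and the behaviour of
    the other subtree. *)
Definition window_spec A := forall u (S : pred word) B t t', indep E S B ->
  (forall v, S (u ++ v)) -> 0 <= t < t' ->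
  pr (B `&` window u A t t') = pr B * window_prob A t t'.

(** Independence of a window event from the other clocks follows from its
    probability formula, applied to [B] intersected with cylinders. *)
Lemma indep_window A u (S S' : pred word) B t t' : window_spec A ->
  indep E S B -> (forall v, S (u ++ v)) -> 0 <= t < t' ->
  subpred S' S -> (forall v, ~~ S' (u ++ v)) -> indep E S' (B `&` window u A t t').
Proof.
move=> specA iB Su tt' S'S S'u; split.
  by apply: measurableI; [case: iB|exact: measurable_window].
move=> s C us Ss mC.
rewrite -setIA [window _ _ _ _ `&` _]setIC setIA.
pose S'' : pred word := fun v => prefix u v.
have iB' : indep E S'' (B `&` cylinder E s C).
  apply: (indep_cylinder iB) => //.
  - by apply: sub_all Ss.
  - by move=> v /prefixP[v' ->].
  - by move=> v /prefixP[v' ->]; apply/negP => /(allP Ss); apply/negP.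
rewrite (specA _ _ _ _ _ iB') //; last by move=> v; exact: prefix_prefix.
rewrite (specA _ _ _ _ _ iB) // mulrAC; congr (_ * _).
case: iB => mB ->; rewrite //; exact: sub_all Ss.
Qed.

Lemma prob_children A0 A1 u (S : pred word) B a b t t' :
  window_spec A0 -> window_spec A1 -> indep E S B ->
  (forall v, S (u ++ v)) -> 0 <= a <= b -> 0 <= t < t' ->
  pr (B `&` E u @^-1` `]a, b] `&` children u A0 A1 t t') =
  pr B * ((expR (- a) - expR (- b)) * (window_prob A0 t t' * window_prob A1 t t')).
Proof.
move=> spec0 spec1 iB Su ab tt'.
pose S1 : pred word := fun v => prefix u v && (v != u).
have Su' v : S1 (u ++ v) = (v != [::]).
  by rewrite /S1 prefix_prefix -{2}[u]cats0 eqseq_cat // eqxx.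
have [iB1 E1] : indep E S1 (B `&` E u @^-1` `]a, b]) /\
    pr (B `&` E u @^-1` `]a, b]) = pr B * pr (E u @^-1` `]a, b]).
  apply: (indep_clock iB) => //.
  - by rewrite -[u]cats0.
  - by move=> v /andP[/prefixP[v' ->]].
  - by rewrite /S1 eqxx andbF.
have iB2 : indep E (prefix (u ++ [:: true]))
    (B `&` E u @^-1` `]a, b] `&` window (u ++ [:: false]) A0 t t').
  apply: (indep_window spec0 iB1) => //.
  - by move=> v; rewrite -catA Su'.
  - by move=> v /prefixP[v' ->]; rewrite -catA Su'.
  - move=> v; rewrite -!catA; elim: (u) => //=.
    by move=> x u'; rewrite eqxx.
rewrite /children setIA (spec1 _ _ _ _ _ iB2) //; last exact: prefix_prefix.
rewrite (spec0 _ _ _ _ _ iB1) //; last by move=> v; rewrite -catA Su'.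
by rewrite E1 prob_clock_oc // !mulrA.
Qed.

End Window.

Section WindowProb.
Context d (Omega : measurableType d) (R : realType) (P : probability Omega R).
Variable E : word -> {RV P >-> R}.
Hypothesis Elaw : forall u, has_law P (E u) (exponential_prob (1 : R)).
Hypothesis Eind : mutually_independent P E.
Local Notation pr := (prob P).

Lemma window_probM A0 A1 (t t' : R) : window_prob A0 t t' * window_prob A1 t t' =
  weight R A0 * weight R A1 *
  (expR (- t') ^+ (inner A0 + inner A1).+2 * (expR t - 1) ^+ (inner A0 + inner A1)).
Proof.
by rewrite /window_prob -addSn -addnS !exprD; ring.
Qed.

Lemma window_prob_Node A0 A1 (t t' : R) : window_prob (Node A0 A1) t t' =
  weight R A0 * weight R A1 * (expR (- t') ^+ (inner A0 + inner A1).+2 *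
    ((expR t - 1) ^+ (inner A0 + inner A1).+1 / (inner A0 + inner A1).+1%:R)).
Proof. by rewrite /window_prob /=; ring. Qed.

Lemma cvg_geometric_ratio (t c l : R) N :
  let q m := expR (t / m.+1%:R) in
  q m ^+ N.+2 * (c - (q m)^-1) ^+ N.+1 / l @[m --> \oo] --> (c - 1) ^+ N.+1 / l /\
  q m ^- N.+2 * (c - q m) ^+ N.+1 / l @[m --> \oo] --> (c - 1) ^+ N.+1 / l.
Proof.
move=> q; have c0 : t / m.+1%:R @[m --> \oo] --> t * 0.
  by apply: cvgM; [exact: cvg_cst|exact: cvg_harmonic].
have cX (f : nat -> R) k (x : R) : f m @[m --> \oo] --> x -> f m ^+ k @[m --> \oo] --> x ^+ k.
  by move=> fx; exact: (cvg_comp _ _ fx (@exprn_continuous R k x)).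
have q1 : q m @[m --> \oo] --> (1 : R).
  have : q m @[m --> \oo] --> expR (t * 0).
    exact: (cvg_comp _ _ c0 (@continuous_expR R (t * 0))).
  by rewrite mulr0 expR0.
have qX k : q m ^+ k @[m --> \oo] --> (1 : R) by have := cX _ k _ q1; rewrite expr1n.
have qV (f : nat -> R) : f m @[m --> \oo] --> (1 : R) -> (f m)^-1 @[m --> \oo] --> (1 : R).
  by move=> /(cvgV (oner_neq0 R)); rewrite invr1.
have mul1 (f g : nat -> R) (x : R) : f m @[m --> \oo] --> (1 : R) -> g m @[m --> \oo] --> x ->
    f m * g m @[m --> \oo] --> x.
  move=> f1 gx; have h : f m * g m @[m --> \oo] --> 1 * x by exact: cvgM.
  by rewrite mul1r in h.
split; (apply: cvgM; last exact: cvg_cst); apply: mul1.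
- exact: qX.
- by apply: cX; apply: cvgB; [exact: cvg_cst|exact: qV].
- exact/qV/qX.
- by apply: cX; apply: cvgB; [exact: cvg_cst|].
Qed.

(** For a node, cut the range of the root clock into [m] intervals of length
    [t / m].  If the clock rings in ](j * eps), (j + 1) * eps] then the window of
    the children, which starts when the clock rings, lies between two windows
    with deterministic ends, whose probabilities are known by induction.
    Both bounds are geometric Riemann sums with the same limit. *)
Lemma window_spec_tree A : window_spec E A.
Proof.
elim: A => [|A0 spec0 A1 spec1] u S B t t' iB Su tt'; have /andP[t0 ltt] := tt'.
  have Su0 : S u by rewrite -[u]cats0.
  have mI : measurable (`]t', +oo[ : set R) by exact: measurable_itv.
  have sub0 : subpred pred0 S by [].
  have [_] := @indep_clock _ _ _ _ E S pred0 B u _ iB Su0 mI sub0 isT.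
  rewrite window_Leaf // => ->.
  rewrite prob_clock_gt ?(le_trans t0 (ltW ltt)) //.
  by rewrite /window_prob /= mul1r expr1 expr0 mulr1.
have mB : measurable B by case: iB.
set N := (inner A0 + inner A1)%N.
pose q m := expR (t / m.+1%:R).
have qE m : expR t = q m ^+ m.+1.
  by rewrite /q -expRM_natl mulrCA divff ?mulr1 // pnatr_eq0.
have q1 m : 1 <= q m by rewrite -expR0 ler_expR divr_ge0.
pose eps m : R := t / m.+1%:R.
have eps0 m : 0 <= eps m by rewrite divr_ge0.
have epsE m k : expR (k%:R * eps m) = q m ^+ k by rewrite expRM_natl.
have le_eps m j k : (j <= k)%N -> j%:R * eps m <= k%:R * eps m.
  by move=> jk; rewrite ler_wpM2r // ler_nat.
have le_eps_t m j : (j <= m.+1)%N -> j%:R * eps m <= t.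
  move=> jm; apply: le_trans (le_eps m _ _ jm) _.
  by rewrite /eps mulrCA divff ?mulr1 // pnatr_eq0.
pose I m (j : nat) : set R := [set` `](j%:R * eps m), (j.+1%:R * eps m)]%R].
have mclock (J : set R) : measurable J -> measurable (E u @^-1` J).
  by move=> mJ; exact: measurable_clock.
have mBI m j : measurable (B `&` E u @^-1` I m j).
  by apply: measurableI => //; apply: mclock; exact: measurable_itv.
have mW := measurable_window E u (Node A0 A1) t t'.
pose K := weight R A0 * weight R A1 * expR (- t') ^+ N.+2.
have piece m j s s' : 0 <= s < s' ->
    pr (B `&` E u @^-1` I m j `&` children E u A0 A1 s s') =
    pr B * ((q m ^- j - q m ^- j.+1) * (window_prob A0 s s' * window_prob A1 s s')).
  move=> ss'; rewrite (prob_children Elaw spec0 spec1 iB) //.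
    by rewrite !expRN !epsE.
  by rewrite mulr_ge0 //= le_eps.
have Keq m j k l : (j <= m)%N ->
  window_prob A0 (t - k%:R * eps m) (t' - l%:R * eps m) *
    window_prob A1 (t - k%:R * eps m) (t' - l%:R * eps m) =
  K * ((q m ^+ l) ^+ N.+2 * (q m ^+ m.+1 / q m ^+ k - 1) ^+ N).
  move=> jm; rewrite window_probM -/N.
  have -> : expR (- (t' - l%:R * eps m)) = expR (- t') * q m ^+ l.
    by rewrite opprB addrC expRD epsE.
  have -> : expR (t - k%:R * eps m) = q m ^+ m.+1 / q m ^+ k.
    by rewrite expRD expRN epsE -qE.
  by rewrite exprMn /K; ring.
have [cvg_up cvg_lo] := cvg_geometric_ratio t (expR t) N.+1%:R N.
have prK0 : 0 <= pr B * K.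
  apply: mulr_ge0; first exact: prob_ge0.
  apply: mulr_ge0; first by apply: mulr_ge0; exact: weight_ge0.
  by apply: exprn_ge0; exact: expR_ge0.
have -> : pr B * window_prob (Node A0 A1) t t' =
    pr B * K * ((expR t - 1) ^+ N.+1 / N.+1%:R).
  by rewrite window_prob_Node /K; ring.
apply/eqP; rewrite eq_le; apply/andP; split.
- apply: (@ler_cvg_to nat \oo _ R (fun=> pr (B `&` window E u (Node A0 A1) t t'))
    (fun m => pr B * K * (q m ^+ N.+2 * (expR t - (q m)^-1) ^+ N.+1 / N.+1%:R))).
  + exact: cvg_cst.
  + by apply: cvgM; [exact: cvg_cst|exact: cvg_up].
  (* the smaller window of the children must not be empty *)
  have small : \forall m \near \oo, eps m < t' - t.
    have : eps m @[m --> \oo] --> (0 : R).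
      by rewrite -[X in _ --> X](mulr0 t); apply: cvgM; [exact: cvg_cst|exact: cvg_harmonic].
    by move/cvgr_lt; apply; rewrite subr_gt0.
  near=> m; have em : eps m < t' - t by near: m.
  pose F (o : option nat) := if o is Some j then
    B `&` E u @^-1` I m j `&`
      children E u A0 A1 (t - j%:R * eps m) (t' - j.+1%:R * eps m)
    else ~` positive_clocks E.
  have mF o : measurable (F o).
    case: o => [j|] /=; first by apply: measurableI => //; exact: measurable_children.
    by apply: measurableC; exact: measurable_positive_clocks.
  have [s sE] : exists s, s = iota 0 m.+1 by exists (iota 0 m.+1).
  have := @prob_le_sum _ _ _ P _ (None :: map Some s) F
     (B `&` window E u (Node A0 A1) t t') mF (measurableI _ _ mB mW).
  rewrite !big_cons !big_map prob_positive_clocks // add0r => h.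
  apply: le_trans (h _) _.
    move=> w [Bw Ww]; have [pos|npos] := pselect (positive_clocks E w); last by left.
    right; apply/bigsetU_seqP.
    have /window_NodeE[[en0 _] _] := Ww.
    have Et : E u w <= t.
      rewrite -subr_ge0; apply: le_trans en0; apply: entry_ge0 => v.
      exact/ltW/pos.
    have tpos : 0 < t by exact: lt_le_trans (pos u) Et.
    have epos : 0 < eps m by rewrite divr_gt0.
    have [j [jm jl jr]] : exists j, [/\ (j < m.+1)%N, j%:R * eps m < E u w &
        E u w <= j.+1%:R * eps m].
      have ex : exists k, E u w <= k%:R * eps m.
        by exists m.+1; rewrite /eps mulrCA divff ?mulr1 // pnatr_eq0.
      case: (ex_minnP ex) => -[|k] hk kmin.
        by have := pos u; rewrite ltNge (le_trans hk) // mul0r.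
      exists k; split => //.
        by apply: kmin; rewrite /eps mulrCA divff ?mulr1 // pnatr_eq0.
      by rewrite ltNge; apply/negP => /kmin; rewrite ltnn.
    have js : j \in s by rewrite sE mem_iota.
    exists j => //.
    split; first by split=> //=; rewrite /I /= in_itv /= jl.
    have := (window_NodeE E u A0 A1 t t' w).1 Ww; apply: children_mono.
      by rewrite lerB // ltW.
    by rewrite lerB.
  rewrite sE -[iota 0 m.+1]/(index_iota 0 m.+1) big_mkord.
  rewrite (eq_bigr (fun j : 'I_m.+1 => pr B * K * ((q m ^- j - q m ^- j.+1) *
     ((q m ^+ j.+1) ^+ N.+2 * (q m ^+ m.+1 / q m ^+ j - 1) ^+ N)))).
    rewrite -mulr_sumr ler_wpM2l // [in leRHS](qE m).
    exact: geometric_sum_le.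
  move=> [j jm] _ /=; rewrite piece.
    by rewrite (Keq _ j) //; ring.
  rewrite subr_ge0 le_eps_t 1?ltnW //=.
  rewrite -subr_gt0; move: em; rewrite -subr_gt0 -natr1; lra.
- apply: (@ler_cvg_to nat \oo _ R
    (fun m => pr B * K * (q m ^- N.+2 * (expR t - q m) ^+ N.+1 / N.+1%:R))
    (fun=> pr (B `&` window E u (Node A0 A1) t t'))).
  + by apply: cvgM; [exact: cvg_cst|exact: cvg_lo].
  + exact: cvg_cst.
  apply: nearW => m.
  pose F j := B `&` E u @^-1` I m j `&`
      (if (j < m.+1)%N then children E u A0 A1 (t - j.+1%:R * eps m) (t' - j%:R * eps m)
       else set0).
  have mF j : measurable (F j).
    apply: measurableI => //; case: ifP => // _; exact: measurable_children.
  have := @sum_prob_le _ _ _ P _ (iota 0 m.+1) F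
     (B `&` window E u (Node A0 A1) t t') (iota_uniq _ _) mF (measurableI _ _ mB mW).
  move=> h; apply: le_trans (h _ _); last 2 first.
  + move=> j w [[Bw]]; rewrite /I /= in_itv /= => /andP[jl jr].
    case: ifP => // _ h'; split=> //; apply/window_NodeE.
    apply: children_mono h'; first by rewrite lerB.
    by rewrite lerB // ltW.
  + move=> i j w [[_ +] _] [[_ +] _]; rewrite /I /= !in_itv /= => /andP[il ir] /andP[jl jr].
    have lt_eps k l : k%:R * eps m < E u w -> E u w <= l.+1%:R * eps m -> (k <= l)%N.
      move=> a b; rewrite leqNgt; apply/negP => lk.
      by have := le_lt_trans (le_trans b (le_eps m _ _ lk)) a; rewrite ltxx.
    by apply/eqP; rewrite eqn_leq !lt_eps.
  rewrite -[iota 0 m.+1]/(index_iota 0 m.+1) big_mkord.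
  rewrite (eq_bigr (fun j : 'I_m.+1 => pr B * K * ((q m ^- j - q m ^- j.+1) *
     ((q m ^+ j) ^+ N.+2 * (q m ^+ m.+1 / q m ^+ j.+1 - 1) ^+ N)))).
    rewrite -mulr_sumr ler_wpM2l // [in leLHS](qE m).
    exact: geometric_sum_ge.
  move=> [j jm] _ /=; rewrite /F jm piece.
    by rewrite (Keq _ j) //; ring.
  rewrite subr_ge0 le_eps_t //=.
  by apply: ltr_leB => //; exact: le_eps.
Unshelve. all: by end_near.
Qed.

Lemma prob_window A t t' : 0 <= t < t' ->
  pr (window E [::] A t t') = window_prob A t t'.
Proof.
move=> tt'; have := @window_spec_tree A [::] predT setT t t' (indepT Eind) (fun=> isT) tt'.
by rewrite setTI probT mul1r.
Qed.

End WindowProb.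

(** * Visited trees and almost sure regularity *)

Section VisitSums.
Variable R : realType.

(** For [r = e ^ (- h)] and [n = inner A], the right-hand side times [weight A]
    is the probability that [A] is the current tree at some time of the grid
    [0, h, .., J h] but no longer at the next one. *)
Lemma visit_sum_ge (r : R) n J : 0 <= r <= 1 ->
  r ^+ n.+1 * (1 - r ^+ J) ^+ n.+1 <=
  \sum_(j < J.+1) (1 - r ^+ n.+1) * (r ^+ j * (1 - r ^+ j) ^+ n).
Proof.
move=> r01; have [r0 r1] : 0 <= r /\ r <= 1 by case/andP: r01.
have rX k : 0 <= 1 - r ^+ k by rewrite subr_ge0 exprn_ile1.
elim: J => [|J IH].
  rewrite big_ord_recl big_ord0 expr0 subrr expr0n /= mulr0 addr0 mul1r.
  by rewrite mulr_ge0 ?rX // exprn_ge0.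
rewrite big_ord_recr /=; apply: le_trans (lerD IH (lexx _)).
rewrite -lerBlDl -mulrBr.
have le1 : 0 <= 1 - r ^+ J <= 1 - r ^+ J.+1.
  by rewrite rX lerB // ler_wiXn2l.
have /andP[_ h1] := power_diff_le n le1.
have /andP[h2 _] := @power_diff_le R n 1 r r01.
rewrite expr1n in h2.
apply: le_trans (ler_wpM2l _ h1) _; first exact: exprn_ge0.
have -> : r ^+ n.+1 * (n.+1%:R * (1 - r ^+ J.+1) ^+ n * (1 - r ^+ J.+1 - (1 - r ^+ J))) =
   (n.+1%:R * r ^+ n * (1 - r)) * (r ^+ J.+1 * (1 - r ^+ J.+1) ^+ n).
  by rewrite !exprS; ring.
by rewrite ler_wpM2r // mulr_ge0 ?exprn_ge0.
Qed.

Lemma bernoulli_ineq (y : R) n : 0 <= y <= 1 -> 1 - n%:R * y <= (1 - y) ^+ n.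
Proof.
case: n => [|n] /andP[y0 y1]; first by rewrite mul0r subr0 expr0.
have := @power_diff_le R n 1 (1 - y).
rewrite subr_ge0 y1 gerBl y0 => /(_ isT) /andP[_].
by rewrite !expr1n mulr1 opprB addrCA subrr addr0 => h; rewrite lerBlDr -lerBlDl.
Qed.

End VisitSums.

Definition trees_between K L := [seq A | n <- iota K L, A <- trees n].

Lemma uniq_trees_between K L : uniq (trees_between K L).
Proof.
apply: allpairs_uniq_dep; first exact: iota_uniq.
  by move=> n _; exact: uniq_trees.
move=> x y /allpairsPdep[i [A [_ + ->]]] /allpairsPdep[j [B [_ + ->]]] /= AB.
by rewrite !mem_trees => /eqP <- /eqP <-; rewrite AB.
Qed.

Lemma mem_trees_between K L A : A \in trees_between K L -> (K <= inner A)%N.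
Proof.
move=> /allpairsPdep[n [B [+ + ->]]]; rewrite mem_iota mem_trees => /andP[h _] /eqP ->.
exact: h.
Qed.

Section Visits.
Context d (Omega : measurableType d) (R : realType) (P : probability Omega R).
Variable E : word -> {RV P >-> R}.
Hypothesis Elaw : forall u, has_law P (E u) (exponential_prob (1 : R)).
Hypothesis Eind : mutually_independent P E.
Local Notation pr := (prob P).
Local Notation pos := (positive_clocks E).

Lemma prob_positive X : measurable X -> pr (X `&` pos) = pr X.
Proof.
move=> mX; have mpos := measurable_positive_clocks E.
have mXp : measurable (X `&` pos) by exact: measurableI.
apply/eqP; rewrite eq_le; apply/andP; split; first by apply: prob_le => // ? [].
have := @prob_le_sum _ _ _ P bool [:: true; false]
  (fun b => if b then X `&` pos else ~` pos) X.
rewrite !big_cons !big_nil addr0 prob_positive_clocks // addr0; apply => //.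
  by case=> //; exact: measurableC.
rewrite setU0 => w Xw; have [p|np] := pselect (pos w); [by left|by right].
Qed.

(** The window formula is for [t < t']; here [t'] decreases to [t]. *)
Lemma prob_window_now_ge A t : 0 <= t -> window_prob A t t <= pr (window E [::] A t t).
Proof.
move=> t0; apply: (@ler_cvg_to nat \oo _ R (fun m => window_prob A t (t + m.+1%:R^-1))
  (fun=> pr (window E [::] A t t))); last 2 first.
- exact: cvg_cst.
- apply: nearW => m; rewrite -(prob_window Elaw Eind); last first.
    by rewrite t0 ltrDl invr_gt0 ltr0n.
  apply: prob_le; try exact: measurable_window.
  by move=> w [h1 h2]; split => //; apply: le_lt_trans h2; rewrite lerDl.
apply: cvgM; last exact: cvg_cst.
apply: cvgM; first exact: cvg_cst.
have c : - (t + m.+1%:R^-1) @[m --> \oo] --> - t.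
  apply: cvgN; rewrite -[X in _ --> X]addr0.
  by apply: cvgD; [exact: cvg_cst|exact: cvg_harmonic].
have c' := cvg_comp _ _ c (@continuous_expR R (- t)).
exact: (cvg_comp _ _ c' (@exprn_continuous R _ _)).
Qed.

Lemma sum_window_prob n t :
  \sum_(A <- trees n) window_prob A t t = expR (- t) * (1 - expR (- t)) ^+ n :> R.
Proof.
have -> : \sum_(A <- trees n) window_prob A t t =
    \sum_(A <- trees n) weight R A * (expR (- t) ^+ n.+1 * (expR t - 1) ^+ n).
  by apply: eq_big_seq => A; rewrite mem_trees /window_prob mulrA => /eqP ->.
rewrite -mulr_suml sum_weight mul1r exprS -mulrA -exprMn mulrBr mulr1.
by rewrite -expRD addNr expR0.
Qed.

(** The bound is the tail of the geometric law of parameter [e ^ (- t)].  With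
    [K = 0] it shows that the tree at time [t] is almost surely finite. *)
Lemma prob_at_least t K X : 0 <= t -> measurable X ->
  (forall A w, (K <= inner A)%N -> pos w -> window E [::] A t t w -> X w) ->
  (1 - expR (- t)) ^+ K <= pr X.
Proof.
move=> t0 mX hX; set y := 1 - expR (- t).
have y01 : 0 <= y < 1.
  by rewrite subr_ge0 -[X in _ <= X]expR0 ler_expR oppr_le0 t0 gtrBl expR_gt0.
have /andP[y0 y1] := y01.
apply: (@ler_cvg_to nat \oo _ R (fun L => y ^+ K - y ^+ (K + L)) (fun=> pr X)); last 2 first.
- exact: cvg_cst.
- apply: nearW => L; apply: (@le_trans _ _ (\sum_(A <- trees_between K L) window_prob A t t)).
    rewrite big_allpairs_dep /=.
    rewrite (eq_bigr (fun n => (1 - y) * y ^+ n)); last first.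
      by move=> n _; rewrite sum_window_prob /y opprB addrCA subrr addr0.
    elim: L => [|L IH]; first by rewrite addn0 subrr big_nil.
    rewrite -[L.+1]addn1 iotaD big_cat /= big_seq1; apply: le_trans (lerD IH (lexx _)).
    by rewrite addnA addn1 exprS; rewrite le_eqVlt; apply/orP; left; apply/eqP; ring.
  apply: (@le_trans _ _ (\sum_(A <- trees_between K L)
      pr (window E [::] A t t `&` pos `&` (if (K <= inner A)%N then setT else set0)))).
    rewrite big_seq [leRHS]big_seq; apply: ler_sum => A /mem_trees_between ->.
    rewrite setIT prob_positive; last exact: measurable_window.
    exact: prob_window_now_ge.
  apply: sum_prob_le => //.
  + exact: uniq_trees_between.
  + move=> A; apply: measurableI; last by case: ifP.
    by apply: measurableI; [exact: measurable_window|exact: measurable_positive_clocks].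
  + by move=> A w [[hw hp]]; case: ifP => // hA _; exact: hX hA hp hw.
  + move=> A B w [[hA hp] _] [[hB _] _].
    by apply: (@at_time_inj R A B (clocks E w) t); [move=> u; exact/ltW/hp|exact/andP..].
rewrite -[X in _ --> X]subr0; apply: cvgB; first exact: cvg_cst.
under eq_fun do rewrite exprD.
rewrite -(mulr0 (y ^+ K)); apply: cvgM; first exact: cvg_cst.
by apply: cvg_expr; rewrite ger0_norm.
Qed.

End Visits.

Section GoodClocks.
Variable R : realType.

Definition visited A (e : word -> R) := entry A e < exit A e.

(** The second condition says that the process does not explode, the third one
    that no two clocks ring at the same time. *)
Definition good_clocks (e : word -> R) : Prop :=
  [/\ forall u, 0 < e u,
      forall t, 0 <= t -> exists A, at_time A e t
    & forall n, exists2 A, inner A = n & visited A e].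

Lemma visited_inj A B (e : word -> R) : (forall u, 0 <= e u) ->
  visited A e -> visited B e -> inner A = inner B -> A = B.
Proof.
move=> e0 vA vB; apply: (@at_time_ninner R A B e (entry A e) (entry B e)) => //.
  by rewrite /at_time lexx.
by rewrite /at_time lexx.
Qed.

End GoodClocks.

Section AlmostSurelyGood.
Context d (Omega : measurableType d) (R : realType) (P : probability Omega R).
Variable E : word -> {RV P >-> R}.
Hypothesis Elaw : forall u, has_law P (E u) (exponential_prob (1 : R)).
Hypothesis Eind : mutually_independent P E.
Local Notation pr := (prob P).
Local Notation pos := (positive_clocks E).

(** The restriction to positive clocks makes these events disjoint for trees of
    the same size. *)
Definition visits A : set Omega := [set w | visited A (clocks E w)] `&` pos.

Lemma measurable_visits A : measurable (visits A).
Proof.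
apply: measurableI; last exact: measurable_positive_clocks.
have -> : [set w | visited A (clocks E w)] =
    (fun w => exit A (clocks E w) - entry A (clocks E w)) @^-1` `]0, +oo[.
  by apply/seteqP; split=> w /=; rewrite in_itv /= andbT subr_gt0.
rewrite -[X in measurable X]setTI; apply: measurable_funB.
- by apply: measurable_exit => v; exact: measurable_funP.
- by apply: measurable_entry => v; exact: measurable_funP.
- exact: measurableT.
- exact: measurable_itv.
Qed.

Lemma visits_inj A B w : visits A w -> visits B w -> inner A = inner B -> A = B.
Proof. by move=> [vA p] [vB _]; apply: (visited_inj _ vA vB) => u; exact/ltW/p. Qed.

(** On a grid of step [h], the last grid times at which the tree is [A] give
    disjoint events, so that their probabilities add up to a lower bound; the
    bound tends to [weight A] as the grid becomes fine. *)
Lemma prob_visits_ge A : weight R A <= pr (visits A).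
Proof.
set n := inner A.
have step (h : R) J : 0 < h ->
    weight R A * (expR (- h) ^+ n.+1 * (1 - expR (- h) ^+ J) ^+ n.+1) <= pr (visits A).
  move=> h0; set r := expR (- h).
  have r01 : 0 <= r <= 1 by rewrite expR_ge0 -expR0 ler_expR oppr_le0 ltW.
  apply: le_trans (ler_wpM2l (weight_ge0 R A) (visit_sum_ge n J r01)) _.
  have hX j : expR (- (j%:R * h)) = r ^+ j by rewrite -mulrN expRM_natl.
  have jh j : 0 <= j%:R * h by rewrite mulr_ge0 // ltW.
  pose now j := window E [::] A (j%:R * h) (j%:R * h).
  pose on j := window E [::] A (j%:R * h) (j.+1%:R * h).
  have le_h i j : (i <= j)%N -> i%:R * h <= j%:R * h by move=> ij; rewrite ler_pM2r // ler_nat.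
  have lt_h j : j%:R * h < j.+1%:R * h by rewrite ltr_pM2r // ltr_nat.
  rewrite mulr_sumr -(big_mkord xpredT
    (fun j => weight R A * ((1 - r ^+ n.+1) * (r ^+ j * (1 - r ^+ j) ^+ n)))).
  have mnow j : measurable (now j) by exact: measurable_window.
  have mon j : measurable (on j) by exact: measurable_window.
  apply: (@le_trans _ _ (\sum_(0 <= j < J.+1) pr ((now j `\` on j) `&` pos))).
    apply: ler_sum => j _; rewrite prob_positive //; last exact: measurableD.
    rewrite probD //; last first.
      by move=> w [h1 h2]; split=> //; apply: lt_trans h2; exact: lt_h.
    apply: le_trans (lerB (prob_window_now_ge Elaw Eind A (jh j)) _); last first.
      by rewrite (prob_window Elaw Eind) // jh lt_h.
    rewrite /window_prob !hX -/n.
    have -> : expR (j%:R * h) = (r ^+ j)^-1 by rewrite -hX expRN invrK.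
    have rj0 : r ^+ j != 0 by rewrite gt_eqF // exprn_gt0 // expR_gt0.
    have -> : (r ^+ j)^-1 - 1 = (1 - r ^+ j) / r ^+ j by field.
    rewrite expr_div_n [r ^+ j.+1]exprS exprMn [(r ^+ j) ^+ n.+1]exprSr.
    rewrite le_eqVlt; apply/orP; left; apply/eqP; field.
    by rewrite expf_neq0.
  apply: sum_prob_le; first exact: iota_uniq.
  - by move=> j; apply: measurableI; [exact: measurableD|exact: measurable_positive_clocks].
  - exact: measurable_visits.
  - by move=> j w [[[h1 h2] _] p]; split => //; exact: le_lt_trans h2.
  - move=> i j w [[ni oi] p] [[nj oj] _].
    wlog ij : i j ni oi nj oj / (i <= j)%N.
      by move=> H; have [ij|/ltnW ij] := leqP i j; [exact: H|apply/esym; exact: H].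
    apply/eqP; rewrite eqn_leq ij /= leqNgt; apply/negP => lij; apply: oi.
    split; first by case: ni.
    by case: nj => _; apply: le_lt_trans; exact: le_h.
have lim1 (h : R) : 0 < h -> weight R A * expR (- h) ^+ n.+1 <= pr (visits A).
  move=> h0; apply: (@ler_cvg_to nat \oo _ R (fun J => weight R A * (expR (- h) ^+ n.+1 *
      (1 - expR (- h) ^+ J) ^+ n.+1)) (fun=> pr (visits A))); last 2 first.
  - exact: cvg_cst.
  - by apply: nearW => J; exact: step.
  apply: cvgM; first exact: cvg_cst.
  rewrite -[X in _ --> X]mulr1; apply: cvgM; first exact: cvg_cst.
  have c : 1 - expR (- h) ^+ J @[J --> \oo] --> 1 - (0 : R).
    apply: cvgB; first exact: cvg_cst.
    by apply: cvg_expr; rewrite ger0_norm ?expR_ge0 // -[ltRHS]expR0 ltr_expR oppr_lt0.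
  have := cvg_comp _ _ c (@exprn_continuous R n.+1 _).
  by rewrite subr0 expr1n.
apply: (@ler_cvg_to nat \oo _ R (fun m => weight R A * expR (- m.+1%:R^-1) ^+ n.+1)
  (fun=> pr (visits A))); last 2 first.
- exact: cvg_cst.
- by apply: nearW => m; apply: lim1; rewrite invr_gt0 ltr0n.
rewrite -[X in _ --> X]mulr1; apply: cvgM; first exact: cvg_cst.
have := cvg_comp _ _ (@cvg_expR_inv R) (@exprn_continuous R n.+1 _).
by rewrite expr1n.
Qed.

Lemma sum_prob_visits_le n C : measurable C ->
  (forall A, inner A = n -> visits A `<=` C) ->
  \sum_(A <- trees n) pr (visits A) <= pr C.
Proof.
move=> mC hC.
have -> : \sum_(A <- trees n) pr (visits A) =
    \sum_(A <- trees n) pr (visits A `&` (if inner A == n then setT else set0)).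
  by apply: eq_big_seq => A; rewrite mem_trees => ->; rewrite setIT.
apply: sum_prob_le => //.
- exact: uniq_trees.
- by move=> A; apply: measurableI; [exact: measurable_visits|case: ifP].
- by move=> A w [vA]; case: ifP => // /eqP hA _; exact: hC vA.
- move=> A B w [vA +] [vB]; case: ifP => // /eqP hA _; case: ifP => // /eqP hB _.
  by apply: visits_inj vA vB _; congruence.
Qed.

(** The lower bounds are equalities: over the trees of a given size the weights
    add up to 1 and the events are disjoint. *)
Lemma prob_visits A : pr (visits A) = weight R A.
Proof.
apply/eqP; rewrite eq_le prob_visits_ge andbT.
have := sum_prob_visits_le (n := inner A) measurableT (fun _ _ _ _ => I).
rewrite probT -[leRHS](sum_weight R (inner A)).
have memA : A \in trees (inner A) by rewrite mem_trees.
rewrite (perm_big _ (perm_to_rem memA)) [leRHS](perm_big _ (perm_to_rem memA)) /=.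
rewrite !big_cons => h; rewrite -(lerD2r (\sum_(B <- rem A (trees (inner A))) weight R B)).
apply: le_trans h; rewrite lerD2l; apply: ler_sum => B _; exact: prob_visits_ge.
Qed.

Lemma measurable_visits_size n : measurable (\big[setU/set0]_(A <- trees n) visits A).
Proof. by apply: bigsetU_measurable => A _; exact: measurable_visits. Qed.

Lemma ae_prob1 (X : set Omega) : measurable X -> 1 <= pr X -> {ae P, forall w, X w}.
Proof.
move=> mX h; exists (~` X); split => //; first exact: measurableC.
have : pr (~` X) = 0.
  by rewrite probC //; apply/eqP; rewrite subr_eq0 eq_sym eq_le h prob_le1.
rewrite probE; last exact: measurableC.
by move=> ->.
Qed.

Lemma ae_visits n : {ae P, forall w, exists2 A, inner A = n & visited A (clocks E w)}.
Proof.
have := ae_prob1 (measurable_visits_size n).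
have -> : 1 <= pr (\big[setU/set0]_(A <- trees n) visits A).
  rewrite -[leLHS](sum_weight R n).
  rewrite (eq_bigr (fun A => pr (visits A))); last by move=> A _; rewrite prob_visits.
  apply: sum_prob_visits_le; first exact: measurable_visits_size.
  by move=> A hA w vA; apply/bigsetU_seqP; exists A => //; rewrite mem_trees hA.
move=> /(_ isT); apply: filterS => w /bigsetU_seqP[A + [vA _]].
by rewrite mem_trees => /eqP hA; exists A.
Qed.

Definition tree_at (K : nat) t : set Omega :=
  \bigcup_(L : nat) \big[setU/set0]_(A <- trees_between K L) window E [::] A t t.

Lemma measurable_tree_at K t : measurable (tree_at K t).
Proof.
by apply: bigcup_measurable => L _; apply: bigsetU_measurable => A _; exact: measurable_window.
Qed.

Lemma tree_atP K t w : tree_at K t w <->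
  exists2 A, (K <= inner A)%N & at_time A (clocks E w) t.
Proof.
split.
  move=> [L _] /bigsetU_seqP[A hA [h1 h2]]; exists A; last exact/andP.
  exact: mem_trees_between hA.
move=> [A hA /andP h]; exists (inner A).+1 => //; apply/bigsetU_seqP; exists A => //.
apply/allpairsPdep; exists (inner A), A; split => //; last by rewrite mem_trees.
by rewrite mem_iota; lia.
Qed.

Lemma prob_tree_at K t : 0 <= t -> (1 - expR (- t)) ^+ K <= pr (tree_at K t).
Proof.
move=> t0; apply: prob_at_least => //; first exact: measurable_tree_at.
by move=> A w hA _ h; apply/tree_atP; exists A => //; exact/andP.
Qed.

Lemma ae_good_clocks : {ae P, forall w, good_clocks (clocks E w)}.
Proof.
have aeT : {ae P, forall w, forall k : nat, exists A, at_time A (clocks E w) k%:R}.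
  apply/ae_foralln => k.
  have := ae_prob1 (measurable_tree_at 0 k%:R).
  have := prob_tree_at 0 (ler0n R k); rewrite expr0 => h /(_ h).
  by apply: filterS => w /tree_atP[A _ hA]; exists A.
have aeV := ae_foralln ae_visits.
have aeP := ae_positive_clocks Elaw.
apply: (filterS3 _ _ aeT aeV aeP) => w hT hV hP; split=> // t t0.
have [A hA] := hT (Num.truncn t).+1.
apply: (at_time_before _ hA); first by move=> u; exact/ltW/hP.
by rewrite t0 ltW // truncnS_gt.
Qed.

(** At each time [t], the event that [N_t] is at least [x e ^ t] has probability at
    least [1 - x] by the geometric law and Bernoulli's inequality.  On the event
    that [xi < x] it fails for all large times. *)
Lemma ae_limit_gt0 (xi : {RV P >-> R}) :
  {ae P, forall w, (expR (- t) * (nleaves (yule (clocks E w) t))%:R) @[t --> +oo] --> xi w} ->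
  {ae P, forall w, 0 < xi w}.
Proof.
move=> hxi.
pose Z : set Omega := xi @^-1` `]-oo, 0].
have mZ : measurable Z by exact: (@measurable_clock _ _ _ _ (fun _ => xi) [::]).
suff Zx (x : R) : 0 < x -> pr Z <= x.
  have Z0 : pr Z = 0.
    by apply/eqP; rewrite eq_le prob_ge0 andbT; apply/ler_addgt0Pl => x x0; rewrite addr0; exact: Zx.
  exists Z; split => //; first by rewrite probE // Z0.
  by move=> w /= /negP; rewrite -leNgt => h; rewrite /Z /= in_itv.
move=> x0.
pose size (k : nat) := Num.truncn (x * expR k%:R).
pose F K : set Omega := \bigcap_(k in [set k | (K <= k)%N]) ~` (tree_at (size k) k%:R).
have mF K : measurable (F K).
  by apply: bigcap_measurableType => k _; apply: measurableC; exact: measurable_tree_at.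
have prF K : pr (F K) <= x.
  apply: (@le_trans _ _ (pr (~` (tree_at (size K) K%:R)))).
    apply: prob_le => //; first by apply: measurableC; exact: measurable_tree_at.
    by apply: bigcap_inf => /=.
  rewrite probC; last exact: measurable_tree_at.
  rewrite lerBlDr -lerBlDl; apply: le_trans (prob_tree_at _ (ler0n R K)).
  have y01 : 0 <= expR (- K%:R : R) <= 1.
    rewrite expR_ge0 /=; apply: (@le_trans _ _ (expR 0)); last by rewrite expR0.
    by rewrite ler_expR oppr_le0 ler0n.
  apply: le_trans (bernoulli_ineq (size K) y01); rewrite lerB //.
  rewrite expRN ler_pdivrMr ?expR_gt0 // truncn_le.
  by rewrite mulr_ge0 ?expR_ge0 // ltW.
have cvgF : (P \o F) K @[K --> \oo] --> P (\bigcup_K F K).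
  apply: nondecreasing_cvg_mu => //; first exact: bigcup_measurable.
  by move=> n m nm; apply/subsetPset => w h k /= mk; apply: h; exact: leq_trans mk.
have leF : (P (\bigcup_K F K) <= x%:E)%E.
  apply: (cvge_to_le cvgF); apply: nearW => K /=.
  by rewrite probE // lee_fin.
have : {ae P, forall w, Z w -> (\bigcup_K F K) w}.
  apply: (filterS2 _ _ hxi ae_good_clocks) => w cw [w0 wT _] ; rewrite /Z /= in_itv /= => xiw.
  have /(cvgr_lt _ cw)[M [Mr hM]] : xi w < x by exact: le_lt_trans xiw _.
  exists (Num.truncn `|M|).+1 => // k /= Mk /tree_atP[A hA hAt].
  have Mk' : M < k%:R.
    apply: le_lt_trans (ler_norm M) _; apply: lt_le_trans (truncnS_gt _) _.
    by rewrite ler_nat.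
  have := hM _ Mk'; rewrite (nleaves_yule _ hAt); last by move=> u; exact/ltW/w0.
  apply/negP; rewrite -leNgt expRN mulrC ler_pdivlMr ?expR_gt0 //.
  apply: ltW; apply: lt_le_trans (truncnS_gt _) _.
  by rewrite ler_nat.
move=> [N [mN N0 hN]]; have mU : measurable (\bigcup_K F K) by exact: bigcup_measurable.
apply: (@le_trans _ _ (pr (\bigcup_K F K) + pr N)).
  have := @prob_le_sum _ _ _ P bool [:: true; false]
    (fun b => if b then \bigcup_K F K else N) Z.
  rewrite !big_cons !big_nil addr0; apply => //; first by case.
  rewrite setU0 => w Zw; have [|nF] := pselect ((\bigcup_K F K) w); first by left.
  by right; apply: hN => /= /(_ Zw).
by rewrite /prob N0 addr0 -lee_fin -/(prob P _) -probE.
Qed.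

End AlmostSurelyGood.

(** * Harmonic sums and the derivatives of the martingales *)

Section Harmonic.
Variable R : realType.

Definition harmonic_sum (n : nat) : R := \sum_(1 <= k < n.+1) k%:R^-1.

Lemma harmonic_sumS n : harmonic_sum n.+1 = harmonic_sum n + n.+1%:R^-1.
Proof. by rewrite /harmonic_sum big_nat_recr. Qed.

(** The constant is defined as a limit, whose existence follows from
    [1 / (n + 1) <= ln (n + 1) - ln n <= 1 / n]. *)
Lemma cvg_harmonic_sum : (harmonic_sum n - ln n%:R) @[n --> \oo] --> euler_gamma R.
Proof.
suff : cvg ((harmonic_sum n - ln n%:R) @[n --> \oo]) by [].
pose u n : R := harmonic_sum n.+1 - ln n.+1%:R.
suff /cvg_ex[l] : cvgn u.
  rewrite (cvg_shiftS (fun n => harmonic_sum n - ln n%:R)) => ul.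
  by apply/cvg_ex; exists l.
have pos n : (n.+1%:R : R) \is Num.pos by rewrite posrE ltr0n.
have step n : ln (n.+2%:R : R) <= ln n.+1%:R + n.+1%:R^-1.
  have -> : (n.+2%:R : R) = n.+1%:R * (1 + n.+1%:R^-1).
    by rewrite mulrDr mulr1 divff ?pnatr_eq0 // natr1.
  rewrite lnM // ?posrE ?addr_gt0 // lerD2l le_ln1Dx //.
  by apply: lt_le_trans (_ : 0 <= _); rewrite ?ltrN10 ?invr_ge0.
apply: nonincreasing_is_cvgn.
  apply/nonincreasing_seqP => n; rewrite /u [X in X - _ <= _]harmonic_sumS.
  have h : ln (n.+1%:R : R) <= ln n.+2%:R - n.+2%:R^-1.
    have -> : (n.+1%:R : R) = n.+2%:R * (1 + - n.+2%:R^-1).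
      by rewrite mulrBr mulr1 divff ?pnatr_eq0 // -[in RHS]natr1 addrK.
    rewrite lnM // ?lerD2l ?le_ln1Dx // ?posrE ?ltrN2 ?invf_lt1 ?ltr0n ?ltr1n //.
    by rewrite subr_gt0 invf_lt1 ?ltr0n ?ltr1n.
  by rewrite -addrA lerD2l -lerN2 opprK opprB.
exists 0 => _ [n _ <-]; rewrite subr_ge0.
apply: (@le_trans _ _ (ln n.+2%:R)); first by rewrite ler_ln ?ler_nat.
elim: n => [|n IH]; last by apply: le_trans (step n.+1) _; rewrite harmonic_sumS lerD2r.
by apply: le_trans (step 0) _; rewrite ln1 add0r /harmonic_sum big_nat1.
Qed.

End Harmonic.

Section Derivatives.
Variable R : realType.

(** The value on [A] of the derivative at 1 of the martingale of the binary
    search tree: the average depth of the leaves, centred. *)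
Definition centred_length A : R :=
  (path_length A)%:R / (inner A).+1%:R - 2 * (harmonic_sum R (inner A).+1 - 1).

Lemma is_derive_power_sum (s : seq word) :
  is_derive (1 : R) 1 (fun z => \sum_(u <- s) z ^+ size u) (\sum_(u <- s) size u)%N%:R.
Proof.
elim: s => [|u s IH].
  have -> : (fun z : R => \sum_(u <- ([::] : seq word)) z ^+ size u) = cst 0.
    by apply: funext => z; rewrite big_nil.
  rewrite big_nil; exact: is_derive_cst.
have -> : (fun z : R => \sum_(v <- u :: s) z ^+ size v) =
    (fun z => z ^+ size u) + (fun z => \sum_(v <- s) z ^+ size v).
  by apply: funext => z; rewrite big_cons.
have d : is_derive (1 : R) 1 (fun z => z ^+ size u) (size u)%:R.
  have -> : (fun z : R => z ^+ size u) = (id : R -> R) ^+ size u.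
    by apply: funext => z; rewrite exprfctE.
  by apply: is_derive_eq; rewrite expr1n /GRing.scale /= !mulr1.
rewrite big_cons natrD; exact: is_deriveD.
Qed.

Lemma derive_yule_martingale (e : word -> R) A t : (forall u, 0 <= e u) -> at_time A e t ->
  yule_derivative_martingale (yule e) t 1 =
  expR (- t) * ((path_length A)%:R - 2 * t * (inner A).+1%:R).
Proof.
move=> e0 hA; rewrite /yule_derivative_martingale derive1E.
have -> : yule_martingale (yule e) t =
   (fun z => \sum_(u <- leaf_words A) z ^+ size u) * (expR \o (fun z => t * (1 - 2 * z))).
  apply: funext => z; rewrite /yule_martingale (perm_big _ (leaf_fset_yule e0 hA)) /=.
  by rewrite -mulr_suml.
have d1 := is_derive_power_sum (leaf_words A).
have d2 : is_derive (1 : R) 1 (fun z => t * (1 - 2 * z)) (t * - 2).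
  have -> : (fun z : R => t * (1 - 2 * z)) = t *: (cst 1 - 2 *: id).
    by apply: funext.
  by apply: is_derive_eq; rewrite sub0r /GRing.scale /= mulr1.
have d3 : is_derive (1 : R) 1 (expR \o (fun z => t * (1 - 2 * z)))
    (expR (t * (1 - 2 * 1)) * (t * -2)).
  exact: is_derive1_comp.
rewrite derive_val /GRing.scale /= sumn_leaf_words.
have -> : \sum_(u <- leaf_words A) (1 : R) ^+ size u = (inner A).+1%:R.
  rewrite -size_leaf_words -sum1_size natr_sum.
  by apply: eq_bigr => u _; rewrite expr1n.
have -> : t * (1 - 2 * 1) = - t by ring.
ring.
Qed.

Lemma bst_norm1 n : bst_norm n (1 : R) = n.+1%:R.
Proof.
elim: n => [|n IH]; first by rewrite /bst_norm big_nil.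
rewrite /bst_norm big_nat_recr //= -/(bst_norm n 1) IH mulr1.
by rewrite mulrCA divff ?mulr1 ?pnatr_eq0 // -natrD addn2.
Qed.

Lemma is_derive_bst_norm n :
  is_derive (1 : R) 1 (@bst_norm R n) (n.+1%:R * (2 * (harmonic_sum R n.+1 - 1))).
Proof.
elim: n => [|n IH].
  have -> : @bst_norm R 0 = cst 1 by apply: funext => z; rewrite /bst_norm big_nil.
  rewrite /harmonic_sum big_nat1 invr1 subrr !mulr0; exact: is_derive_cst.
have -> : @bst_norm R n.+1 = @bst_norm R n * (fun z => (n%:R + 2 * z) / n.+1%:R).
  by apply: funext => z; rewrite /bst_norm big_nat_recr.
have d : is_derive (1 : R) 1 (fun z => (n%:R + 2 * z) / n.+1%:R) (2 / n.+1%:R).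
  have -> : (fun z : R => (n%:R + 2 * z) / n.+1%:R) = n.+1%:R^-1 *: (cst n%:R + 2 *: id).
    by apply: funext => z /=; rewrite mulrC.
  by apply: is_derive_eq; rewrite add0r /GRing.scale /= mulr1 mulrC.
apply: is_derive_eq; rewrite bst_norm1 /GRing.scale /= !harmonic_sumS mulr1.
have -> : (n%:R + 2 : R) = n.+2%:R by rewrite -natrD addn2.
have : (n.+1%:R : R) != 0 /\ (n.+2%:R : R) != 0 by rewrite !pnatr_eq0.
move: (n.+1%:R : R) (n.+2%:R : R) => a b [a0 b0].
by field; rewrite a0 b0.
Qed.

Lemma derive_bst_martingale (e : word -> R) A : (forall u, 0 <= e u) ->
  at_time A e (jump_time (yule e) (inner A)) ->
  bst_derivative_martingale (yule e) (inner A) 1 = centred_length A.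
Proof.
move=> e0 hA; rewrite /bst_derivative_martingale derive1E.
have -> : bst_martingale (yule e) (inner A) =
   (fun z => (@bst_norm R (inner A) z)^-1) * (fun z => \sum_(u <- leaf_words A) z ^+ size u).
  by apply: funext => z; rewrite /bst_martingale (perm_big _ (leaf_fset_yule e0 hA)).
have d1 := is_derive_power_sum (leaf_words A).
have n0 : ((inner A).+1%:R : R) != 0 by rewrite pnatr_eq0.
have d2 : is_derive (1 : R) 1 (fun z => (@bst_norm R (inner A) z)^-1)
    (- ((inner A).+1%:R) ^- 2 *: ((inner A).+1%:R * (2 * (harmonic_sum R (inner A).+1 - 1)))).
  rewrite -bst_norm1; apply: is_deriveV; first by rewrite bst_norm1.
  by rewrite bst_norm1; exact: is_derive_bst_norm.
rewrite derive_val /GRing.scale /= sumn_leaf_words bst_norm1.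
have -> : \sum_(u <- leaf_words A) (1 : R) ^+ size u = (inner A).+1%:R.
  rewrite -size_leaf_words -sum1_size natr_sum.
  by apply: eq_bigr => u _; rewrite expr1n.
by rewrite /centred_length; field.
Qed.

End Derivatives.

(** * Limits along a regular trajectory *)

Definition left A := if A is Node L _ then L else Leaf.
Definition right A := if A is Node _ L then L else Leaf.
Definition child (i : bool) A := if i then right A else left A.

Lemma eq_cvgn (R : realType) (f g : nat -> R) (l : R) : f =1 g ->
  f n @[n --> \oo] --> l -> g n @[n --> \oo] --> l.
Proof. by move=> /funext ->. Qed.

Section Trajectory.
Variable R : realType.
Implicit Types (e : word -> R) (A : nat -> tree).

Definition history e A := forall n, inner (A n) = n /\ visited (A n) e.

Lemma history_ex e : good_clocks e -> exists A, history e A.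
Proof.
move=> [_ _ h]; have [A hA] := choice (fun n => let: ex_intro2 B b1 b2 := h n in
  ex_intro (fun B => inner B = n /\ visited B e) B (conj b1 b2)).
by exists A.
Qed.

Lemma at_time_entry A e n : history e A -> at_time (A n) e (entry (A n) e).
Proof. by move=> hA; rewrite /at_time lexx /=; have [] := hA n. Qed.

Lemma good_ge0 e : good_clocks e -> forall u, 0 <= e u.
Proof. by move=> [h _ _] u; exact: ltW. Qed.
Hint Resolve good_ge0 : core.

Lemma history_at A e B t : good_clocks e -> history e A -> at_time B e t -> B = A (inner B).
Proof.
move=> ge hA hB; apply: at_time_ninner hB (at_time_entry _ hA) _; first exact: good_ge0.
by have [-> _] := hA (inner B).
Qed.

Lemma jump_time_yule A e n : good_clocks e -> history e A ->
  jump_time (yule e) n = entry (A n) e.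
Proof.
move=> ge hA; have [hn hv] := hA n; have e0 := good_ge0 ge.
rewrite /jump_time (_ : [set _ | _] = [set` `[entry (A n) e, exit (A n) e[%R]).
  by rewrite inf_itv // bnd_simp.
apply/seteqP; split=> t /=; rewrite in_itv /=.
  move=> [t0 ht]; have [_ h _] := ge; have [B hB] := h t t0.
  move: ht; rewrite (nleaves_yule e0 hB) => -[Bn].
  by have := hB; rewrite (history_at ge hA hB) Bn.
move=> h; split; last by rewrite (nleaves_yule e0 h) hn.
by case/andP: h => h _; apply: le_trans h; exact: entry_ge0.
Qed.

Lemma cvg_inner A e (s : nat -> R) (B : nat -> tree) : good_clocks e -> history e A ->
  (forall n, at_time (B n) e (s n)) -> s n @[n --> \oo] --> +oo ->
  inner (B n) @[n --> \oo] --> \oo.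
Proof.
move=> ge hA hB /cvgryPge sy; apply/cvgnyPge => k.
have [N _ hN] := sy (entry (A k) e); exists N => // n Nn /=.
have [<- _] := hA k.
by have [] := at_time_le (good_ge0 ge) (hN n Nn) (at_time_entry k hA) (hB n).
Qed.

Lemma cvg_entry A e : good_clocks e -> history e A -> entry (A n) e @[n --> \oo] --> +oo.
Proof.
move=> ge hA; apply/cvgryPge => M.
have [_ h _] := ge; have [B hB] := h `|M| (normr_ge0 _).
exists (inner B).+1 => // n /= nB; rewrite leNgt; apply/negP => lt_M.
have le_M : entry (A n) e <= `|M| by apply: le_trans (ltW lt_M) (ler_norm _).
have [] := at_time_le (good_ge0 ge) le_M (at_time_entry n hA) hB.
by have [-> _] := hA n; rewrite leqNgt nB.
Qed.

Lemma cvg_centred_length A e (b : R) : good_clocks e -> history e A ->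
  bst_derivative_martingale (yule e) n 1 @[n --> \oo] --> b ->
  centred_length R (A n) @[n --> \oo] --> b.
Proof.
move=> ge hA; rewrite (_ : (fun n => _) = (fun n => centred_length R (A n))) //.
apply: funext => n; have [hn _] := hA n.
rewrite -{1}hn derive_bst_martingale //; first exact: good_ge0.
by rewrite hn (jump_time_yule n ge hA); exact: at_time_entry.
Qed.

(** At the jump times [t], [M'(t, 1)] is [e ^ (- t) N] times the centred path
    length plus [2 (H_N - t - 1)], and [log N - t] tends to [log xi]. *)
Lemma yule_bst_limits e (xi m b : R) : good_clocks e -> 0 < xi ->
  (expR (- t) * (nleaves (yule e t))%:R) @[t --> +oo] --> xi ->
  yule_derivative_martingale (yule e) t 1 @[t --> +oo] --> m ->
  bst_derivative_martingale (yule e) n 1 @[n --> \oo] --> b ->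
  m = xi * (b + 2 * (ln xi + euler_gamma R - 1)).
Proof.
move=> ge xi0 cxi cm cb; have [A hA] := history_ex ge; have e0 := good_ge0 ge.
have ct := cvg_entry ge hA; pose t n := entry (A n) e.
have cb' := cvg_centred_length ge hA cb.
have {}cxi : expR (- t n) * n.+1%:R @[n --> \oo] --> xi.
  apply: (eq_cvgn _ (cvg_comp _ _ ct cxi)) => n /=.
  by rewrite (nleaves_yule e0 (at_time_entry n hA)); have [-> _] := hA n.
have clog : ln n.+1%:R - t n @[n --> \oo] --> ln xi.
  apply: (eq_cvgn _ (cvg_comp _ _ cxi (continuous_ln xi0))) => n /=.
  by rewrite lnM ?posrE ?expR_gt0 ?ltr0n // expRK addrC.
have cH : harmonic_sum R n.+1 - ln n.+1%:R @[n --> \oo] --> euler_gamma R.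
  by rewrite (cvg_shiftS (fun n => harmonic_sum R n - ln n%:R)); exact: cvg_harmonic_sum.
have {}cm : yule_derivative_martingale (yule e) (t n) 1 @[n --> \oo] --> m.
  exact: (cvg_comp _ _ ct cm).
apply: (norm_cvg_unique cm); rewrite /=.
apply: (@eq_cvgn _ (fun n => (expR (- t n) * n.+1%:R) * (centred_length R (A n) +
      2 * ((ln n.+1%:R - t n) + (harmonic_sum R n.+1 - ln n.+1%:R) - 1)))).
  move=> n; rewrite (derive_yule_martingale e0 (at_time_entry n hA)).
  rewrite /centred_length; have [-> _] := hA n.
  have n0 : (n.+1%:R : R) != 0 by rewrite pnatr_eq0.
  move: (ln n.+1%:R) (harmonic_sum R n.+1) => l h.
  by rewrite -/(t n); move: (n.+1%:R : R) n0 => k k0; field.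
apply: cvgM => //; apply: cvgD => //; apply: cvgM; first exact: cvg_cst.
by apply: cvgB; [exact: cvgD|exact: cvg_cst].
Qed.

Lemma subtree_yule e i : good_clocks e -> subtree (yule e) i = yule (below [:: i] e).
Proof.
move=> ge; have [A hA] := history_ex ge.
have E1 : jump_time (yule e) 1 = e [::].
  rewrite (jump_time_yule 1 ge hA); have [+ _] := hA 1%N.
  by case: (A 1%N) => [//|[|? ?] [|? ?]] //= _; rewrite maxxx addr0.
by apply: funext => s; apply/seteqP; split=> v; rewrite /subtree /= E1 yule_cons addrK.
Qed.

Lemma history_Node A e n : history e A -> A n.+1 = Node (left (A n.+1)) (right (A n.+1)).
Proof. by move=> hA; have [+ _] := hA n.+1; case: (A n.+1). Qed.

Section Split.
Variables (e : word -> R) (A : nat -> tree) (A_ : bool -> nat -> tree).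
Variables (xi b : R) (xi_ b_ : bool -> R).
Hypotheses (ge : good_clocks e) (ge_ : forall i, good_clocks (below [:: i] e)).
Hypotheses (hA : history e A) (hA_ : forall i, history (below [:: i] e) (A_ i)).
Hypothesis xi_gt0 : forall i, 0 < xi_ i.
Hypothesis cvg_xi_ : forall i,
  (expR (- s) * (nleaves (subtree (yule e) i s))%:R) @[s --> +oo] --> xi_ i.
Hypothesis cvg_b_ : forall i,
  bst_derivative_martingale (subtree (yule e) i) n 1 @[n --> \oo] --> b_ i.

Let s n := entry (A n.+1) e - e [::].

Lemma at_time_child i n : at_time (child i (A n.+1)) (below [:: i] e) (s n).
Proof.
have := at_time_entry n.+1 hA; rewrite {1}(history_Node n hA) at_time_Node.
by rewrite -/(s n); case: i => /andP[].
Qed.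

Lemma cvg_child_time : s n @[n --> \oo] --> +oo.
Proof.
have := cvg_entry ge hA; rewrite -(cvg_shiftS (fun n => entry (A n) e)) => h.
by apply/cvgryPge => M; move/cvgryPge : h => /(_ (M + e [::])); apply: filterS => n;
  rewrite /s lerBrDr.
Qed.

(** As the sizes of the subtrees tend to infinity, limits along the jump times of
    a subtree can be read along those of the whole tree. *)
Lemma cvg_inner_child i : inner (child i (A n.+1)) @[n --> \oo] --> \oo.
Proof. exact: (cvg_inner (ge_ i) (hA_ i) (at_time_child i) cvg_child_time). Qed.

Lemma cvg_centred_child i : centred_length R (child i (A n.+1)) @[n --> \oo] --> b_ i.
Proof.
have cb : centred_length R (A_ i n) @[n --> \oo] --> b_ i.
  by apply: (cvg_centred_length (ge_ i) (hA_ i)); rewrite -subtree_yule.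
apply: (eq_cvgn _ (cvg_comp _ _ (cvg_inner_child i) cb)) => n /=.
by rewrite -(history_at (ge_ i) (hA_ i) (at_time_child i n)).
Qed.

Let frac i n : R := (inner (child i (A n.+1))).+1%:R / n.+2%:R.

Lemma inner_children n :
  ((inner (child false (A n.+1))).+1 + (inner (child true (A n.+1))).+1)%N = n.+2.
Proof.
have [h _] := hA n.+1; move: h; rewrite {1}(history_Node n hA) /= => -[h].
by rewrite addSn addnS h.
Qed.

Lemma cvg_frac i : frac i n @[n --> \oo] --> xi_ i / (xi_ false + xi_ true).
Proof.
have c j : expR (- s n) * (inner (child j (A n.+1))).+1%:R @[n --> \oo] --> xi_ j.
  apply: (eq_cvgn _ (cvg_comp _ _ cvg_child_time (@cvg_xi_ j))) => n /=.
  rewrite subtree_yule // (nleaves_yule _ (at_time_child j n)) //.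
  exact: good_ge0 (ge_ j).
apply: (@eq_cvgn _ (fun n => expR (- s n) * (inner (child i (A n.+1))).+1%:R /
   (expR (- s n) * (inner (child false (A n.+1))).+1%:R +
    expR (- s n) * (inner (child true (A n.+1))).+1%:R))).
  move=> n; rewrite -mulrDr -natrD inner_children -mulf_div divff ?mul1r //.
  by rewrite gt_eqF // expR_gt0.
apply: cvgM => //; apply: cvgV; first by rewrite gt_eqF // addr_gt0.
exact: cvgD.
Qed.

(** The summand 1 comes from the depths, which increase by 1 when a subtree is
    hung below the root; the harmonic sums are written so that each bracket
    converges. *)
Lemma centred_length_Node L L' :
  let m := ((inner L).+1 + (inner L').+1)%N in
  let term B := (inner B).+1%:R / m%:R * (centred_length R B +
     2 * (harmonic_sum R (inner B).+1 - ln (inner B).+1%:R - (harmonic_sum R m - ln m%:R)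
          + ln ((inner B).+1%:R / m%:R))) in
  centred_length R (Node L L') = term L + term L' + 1.
Proof.
move=> m term; rewrite /term /centred_length /=.
have -> : (inner L + inner L').+2 = m by rewrite /m addSn addnS.
rewrite !ln_div ?posrE ?ltr0n //.
have lm : (m%:R : R) = (inner L).+1%:R + (inner L').+1%:R by rewrite natrD.
have lp : (path_length L + path_length L' + (inner L).+1 + (inner L').+1)%:R =
   (path_length L)%:R + (path_length L')%:R + m%:R :> R.
  by rewrite -!natrD /m !addnA.
rewrite lp.
have l0 : ((inner L).+1%:R : R) != 0 by rewrite pnatr_eq0.
have l'0 : ((inner L').+1%:R : R) != 0 by rewrite pnatr_eq0.
have m0 : (m%:R : R) != 0 by rewrite pnatr_eq0 /m addSn.
move: lm; move: (ln m%:R) (harmonic_sum R m) => lnm Hm lm.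
move: (ln (inner L).+1%:R) (harmonic_sum R (inner L).+1) => lnl Hl.
move: (ln (inner L').+1%:R) (harmonic_sum R (inner L').+1) => lnl' Hl'.
move: l0 l'0 m0; rewrite lm.
move: ((inner L).+1%:R : R) ((inner L').+1%:R : R) => a a' a0 a'0 m0.
by field; rewrite a0 a'0 m0.
Qed.

Lemma quicksort_limit :
  bst_derivative_martingale (yule e) n 1 @[n --> \oo] --> b ->
  let U := xi_ false / (xi_ false + xi_ true) in
  b = U * b_ false + (1 - U) * b_ true + 2 * U * ln U + 2 * (1 - U) * ln (1 - U) + 1.
Proof.
move=> cb U.
have {}cb : centred_length R (A n.+1) @[n --> \oo] --> b.
  by rewrite (cvg_shiftS (fun n => centred_length R (A n))); exact: cvg_centred_length cb.
pose V i := xi_ i / (xi_ false + xi_ true).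
have sum0 : xi_ false + xi_ true != 0 by rewrite gt_eqF // addr_gt0.
have VT : 1 - U = V true by rewrite /U /V; field.
have V0 i : 0 < V i by rewrite /V divr_gt0 ?addr_gt0.
have cH : harmonic_sum R n - ln n%:R @[n --> \oo] --> euler_gamma R.
  exact: cvg_harmonic_sum.
have cHm : harmonic_sum R n.+2 - ln n.+2%:R @[n --> \oo] --> euler_gamma R.
  rewrite (cvg_shiftS (fun n => harmonic_sum R n.+1 - ln n.+1%:R)).
  by rewrite (cvg_shiftS (fun n => harmonic_sum R n - ln n%:R)).
have cHi i : harmonic_sum R (inner (child i (A n.+1))).+1 - ln (inner (child i (A n.+1))).+1%:R
    @[n --> \oo] --> euler_gamma R.
  rewrite -(cvg_shiftS (fun n => harmonic_sum R n - ln n%:R)) in cH.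
  exact: (cvg_comp _ _ (cvg_inner_child i) cH).
pose term i n := frac i n * (centred_length R (child i (A n.+1)) +
   2 * (harmonic_sum R (inner (child i (A n.+1))).+1 - ln (inner (child i (A n.+1))).+1%:R
        - (harmonic_sum R n.+2 - ln n.+2%:R) + ln (frac i n))).
have cterm i : term i n @[n --> \oo] --> V i * (b_ i + 2 * ln (V i)).
  have -> : V i * (b_ i + 2 * ln (V i)) =
      V i * (b_ i + 2 * (euler_gamma R - euler_gamma R + ln (V i))) by ring.
  apply: cvgM; first exact: cvg_frac.
  apply: cvgD; first exact: cvg_centred_child.
  apply: cvgM; first exact: cvg_cst.
  apply: cvgD; first by apply: cvgB.
  have cf : frac i n @[n --> \oo] --> V i by exact: cvg_frac.
  exact: (cvg_comp _ _ cf (continuous_ln (V0 i))).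
apply: (norm_cvg_unique cb); rewrite /=.
apply: (@eq_cvgn _ (fun n => term false n + term true n + 1)).
  move=> n; rewrite {1}(history_Node n hA) centred_length_Node.
  by rewrite /term /frac -(inner_children n).
rewrite VT -/U.
have -> : U * b_ false + V true * b_ true + 2 * U * ln U + 2 * V true * ln (V true) + 1 =
   V false * (b_ false + 2 * ln (V false)) + V true * (b_ true + 2 * ln (V true)) + 1.
  by rewrite -/(V false) -[U]/(V false); ring.
apply: cvgD; last exact: cvg_cst.
exact: cvgD.
Qed.

End Split.
End Trajectory.

(** * Laws on the line and bounded convergence *)

Section Rays.
Variable R : realType.

Lemma measure_eq_rays (m1 m2 : {measure set R -> \bar R}) : (m1 setT < +oo)%E ->
  (forall x, m1 [set` `]-oo, x[%R] = m2 [set` `]-oo, x[%R]) ->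
  forall A, measurable A -> m1 A = m2 A.
Proof.
move=> fin h A mA.
apply: (measure_unique (@RGenInftyO.G R) (fun n : nat => [set` `]-oo, n%:R[%R])) => //.
- exact: RGenInftyO.measurableE.
- move=> _ _ [x ->] [y ->]; exists (Num.min x y).
  by apply/seteqP; split=> z /=; rewrite !in_itv /= lt_min; [move=> [-> ->]|move=> /andP].
- by move=> n; exists n%:R.
- apply/seteqP; split=> // x _; exists (Num.truncn x).+1 => //=.
  by rewrite in_itv /= truncnS_gt.
- by move=> _ [x ->]; exact: h.
- move=> n; apply: le_lt_trans fin; apply: le_measure => //; rewrite inE //.
Qed.

End Rays.

Section LawsFromRays.
Context d (Omega : measurableType d) (R : realType) (P : probability Omega R).
Local Notation pr := (prob P).
Implicit Types X Y : {RV P >-> R}.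

Lemma measurable_RV X (A : set R) : measurable A -> measurable (X @^-1` A).
Proof. by move=> mA; rewrite -[X in measurable X]setTI; exact: measurable_funP. Qed.

(** The event [D] carries the other variables, so that a joint law can be
    identified one coordinate at a time. *)
Lemma prob_eq_rays X Y (D : set Omega) (r : R) : measurable D -> 0 <= r ->
  (forall x, pr (X @^-1` [set` `]-oo, x[%R] `&` D) = r * pr (Y @^-1` [set` `]-oo, x[%R])) ->
  forall A, measurable A -> pr (X @^-1` A `&` D) = r * pr (Y @^-1` A).
Proof.
move=> mD r0 h A mA.
pose m1' : {measure set R -> \bar R} := pushforward (mrestr P mD) X.
pose m2' : {measure set R -> \bar R} := mscale (NngNum r0) (pushforward P Y).
pose m1 := m1' (measurable_funP X); pose m2 := m2' (measurable_funP Y).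
have fin B : measurable B -> m1 B = (pr (X @^-1` B `&` D))%:E.
  move=> mB; rewrite -probE //; apply: measurableI => //; exact: measurable_RV.
have E2 B : measurable B -> m2 B = (r * pr (Y @^-1` B))%:E.
  by move=> mB; rewrite EFinM -probE //; exact: measurable_RV.
apply: EFin_inj; rewrite -fin // -E2 //; apply: measure_eq_rays => //.
  by rewrite fin // ltry.
by move=> x; rewrite fin // E2 // h.
Qed.

(** The inverse is [x |-> x * (x ^ 2) ^ (-1)] with a real power; this is also right
    at [0], where both sides vanish. *)
Lemma measurable_fun_inv (f : Omega -> R) : measurable_fun setT f ->
  measurable_fun setT (fun w => (f w)^-1).
Proof.
move=> mf; have -> : (fun w => (f w)^-1) = (fun w => f w * (f w ^+ 2) `^ (-1)).
  apply: funext => w; have [->|f0] := eqVneq (f w) 0; first by rewrite invr0 mul0r.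
  by rewrite powR_inv1 ?sqr_ge0 // expr2 invfM mulrA divff ?mul1r.
apply: measurable_funM => //.
apply: (@measurableT_comp _ _ _ _ _ _ (@powR R ^~ (-1)) setT (fun w => f w ^+ 2)) => //.
exact: measurable_funX.
Qed.

Definition expect (Y : Omega -> R) : R := fine (\int[P]_w (Y w)%:E).

Lemma bounded_convergence (X : nat -> Omega -> R) (Y : Omega -> R) :
  (forall n, measurable_fun setT (X n)) -> measurable_fun setT Y ->
  {ae P, forall w, X n w @[n --> \oo] --> Y w} ->
  {ae P, forall w, forall n, `|X n w| <= 1} ->
  expect (X n) @[n --> \oo] --> expect Y.
Proof.
move=> mX mY cX bX.
have [] := @dominated_convergence _ _ R P setT measurableT
  (fun n w => (X n w)%:E) (fun w => (Y w)%:E) (cst 1%E).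
- by move=> n; apply/measurable_EFinP.
- exact/measurable_EFinP.
- apply: filterS cX => w h _; apply/fine_cvgP; split; [exact: nearW|exact: h].
- exact: finite_measure_integrable_cst.
- by apply: filterS bX => w h n _; rewrite lee_fin.
move=> iY _ h; apply: fine_cvg; rewrite fineK //.
exact: integrable_fin_num.
Qed.

Lemma expect_indic (A : set Omega) : measurable A -> expect (\1_A) = pr A.
Proof. by move=> mA; rewrite /expect integral_indic // setIT. Qed.

End LawsFromRays.

(** * The limit law at the root *)

Section CesaroProducts.
Variable R : realType.

Lemma cesaro_product (f : nat -> nat -> R) (g h : nat -> R) (cg ch : R) :
  (forall n i, `|f n i| <= 1) -> (forall n, `|h n| <= 1) -> `|cg| <= 1 ->
  g n @[n --> \oo] --> cg -> h n @[n --> \oo] --> ch ->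
  n.+1%:R^-1 * (\sum_(i < n.+1) f n i * (g i * h (n - i)%N))
    - cg * ch * (n.+1%:R^-1 * \sum_(i < n.+1) f n i) @[n --> \oo] --> (0 : R).
Proof.
move=> f1 h1 cg1 gc hc.
pose u i := `|g i - cg| + `|h i - ch|.
have cu : u n @[n --> \oo] --> (0 : R).
  have norm0 (v : nat -> R) c : v n @[n --> \oo] --> c -> `|v n - c| @[n --> \oo] --> (0 : R).
    move=> vc; rewrite -(normr0 R); apply: cvg_norm.
    by rewrite -(subrr c); apply: cvgB => //; exact: cvg_cst.
  by rewrite -(addr0 0); apply: cvgD; exact: norm0.
have cm := cesaro cu.
apply: norm_cvg0.
apply: (@squeeze_cvgr _ _ _ _ (fun=> 0) (arithmetic_mean u)); last 2 first.
- exact: cvg_cst.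
- exact: cm.
apply: nearW => n; rewrite normr_ge0 /=.
rewrite /arithmetic_mean /= mulrCA -mulrBr normrM ger0_norm ?invr_ge0 //.
rewrite ler_wpM2l ?invr_ge0 // mulr_sumr -sumrB.
apply: le_trans (ler_norm_sum _ _ _) _.
rewrite /series /= big_mkord big_split /=.
rewrite [X in _ <= _ + X](reindex_inj rev_ord_inj) /= -big_split /=.
apply: ler_sum => i _; rewrite subSS.
have -> : f n i * (g i * h (n - i)%N) - cg * ch * f n i =
  f n i * ((g i - cg) * h (n - i)%N + cg * (h (n - i)%N - ch)) by ring.
rewrite normrM; apply: (@le_trans _ _ (1 * `|(g i - cg) * h (n - i)%N + cg * (h (n - i)%N - ch)|)).
  by rewrite ler_wpM2r.
rewrite mul1r; apply: le_trans (ler_normD _ _) _; rewrite !normrM lerD //.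
  by rewrite ler_piMr.
by rewrite ler_piMl.
Qed.

End CesaroProducts.

Section MeanLimit.
Context d (Omega : measurableType d) (R : realType) (P : probability Omega R).
Variable E : word -> {RV P >-> R}.
Hypothesis Elaw : forall u, has_law P (E u) (exponential_prob (1 : R)).
Hypothesis Eind : mutually_independent P E.
Local Notation pr := (prob P).

Definition tree_sum (F : tree -> R) n (w : Omega) : R :=
  \sum_(A <- trees n) F A * \1_(visits E A) w.

(** Written as a simple function, the value of [F] on the random tree has a
    finite sum as its expectation. *)
Lemma tree_sumE F n w A : good_clocks (clocks E w) -> history (clocks E w) A ->
  tree_sum F n w = F (A n).
Proof.
move=> gw hA; have [hn hv] := hA n; have [pos _ _] := gw.
have memA : A n \in trees n by rewrite mem_trees hn.
rewrite /tree_sum (perm_big _ (perm_to_rem memA)) big_cons /= indicE mem_set // mulr1.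
rewrite big_seq big1 ?addr0 // => B; rewrite mem_rem_uniq ?uniq_trees // inE mem_trees.
move=> /andP[/eqP BA /eqP Bn]; rewrite indicE memNset ?mulr0 // => vB; apply: BA.
by apply: (visits_inj vB) => //; rewrite Bn hn.
Qed.

Lemma measurable_tree_sum F n : measurable_fun setT (tree_sum F n).
Proof.
apply: measurable_sum => A; apply: measurable_funM; first exact: measurable_cst.
by apply: measurable_indic; exact: measurable_visits.
Qed.

Lemma expect_tree_sum F n : expect P (tree_sum F n) = bst_mean n F.
Proof.
rewrite /expect; under eq_integral do rewrite -sumEFin.
rewrite integral_sum //; last first.
  move=> A; under eq_fun do rewrite EFinM.
  apply: integrableZl => //; apply: integrable_indic.
  exact: measurable_visits.
rewrite (eq_bigr (fun A => (weight R A * F A)%:E)).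
  by rewrite sumEFin.
move=> A _; under eq_integral do rewrite EFinM.
rewrite integralZl //; last first.
  apply: integrable_indic; exact: measurable_visits.
rewrite integral_indic //; last exact: measurable_visits.
rewrite setIT; transitivity ((F A)%:E * (pr (visits E A))%:E)%E.
  by congr (_ * _)%E; apply: probE; exact: measurable_visits.
by rewrite prob_visits // -EFinM mulrC.
Qed.

Lemma cvg_bst_mean (F : tree -> R) (Y : Omega -> R) :
  (forall A, `|F A| <= 1) -> measurable_fun setT Y ->
  {ae P, forall w, forall A, history (clocks E w) A -> F (A n) @[n --> \oo] --> Y w} ->
  bst_mean n F @[n --> \oo] --> expect P Y.
Proof.
move=> F1 mY cF; have aeg := ae_good_clocks Elaw Eind.
apply: (eq_cvgn (expect_tree_sum F)).
apply: bounded_convergence => //; first exact: measurable_tree_sum.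
  apply: (filterS2 _ _ aeg cF) => w gw h; have [A hA] := history_ex gw.
  by apply: (eq_cvgn _ (h A hA)) => n; rewrite (tree_sumE _ _ gw hA).
apply: filterS aeg => w gw n; have [A hA] := history_ex gw.
by rewrite (tree_sumE _ _ gw hA).
Qed.

End MeanLimit.

Section BstMean.
Variable R : realType.

Lemma bst_mean_norm_le1 n (F : tree -> R) : (forall A, `|F A| <= 1) -> `|bst_mean n F| <= 1.
Proof.
move=> F1; apply: le_trans (ler_norm_sum _ _ _) _.
rewrite -[leRHS](sum_weight R n); apply: ler_sum => A _.
by rewrite normrM ger0_norm ?weight_ge0 // ler_piMr ?weight_ge0.
Qed.

Definition root_functional (f g h : R -> R) A : R :=
  f ((inner (left A)).+1%:R / (inner A).+1%:R) *
  (g (centred_length R (left A)) * h (centred_length R (right A))).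

Definition uniform_mean (f : R -> R) n : R :=
  n.+1%:R^-1 * \sum_(i < n.+1) f (i.+1%:R / n.+2%:R).

(** Given the sizes, the two subtrees at the root are independent binary search
    trees, and the size of the left one is uniform. *)
Lemma bst_mean_root f g h n : bst_mean n.+1 (root_functional f g h) =
  n.+1%:R^-1 * \sum_(i < n.+1) f (i.+1%:R / n.+2%:R) *
    (bst_mean i (g \o centred_length R) * bst_mean (n - i) (h \o centred_length R)).
Proof.
rewrite bst_meanS; congr (_ * _); apply: eq_bigr => i _.
rewrite /bst_mean mulr_suml mulr_sumr; apply: eq_big_seq => L; rewrite mem_trees => /eqP hL.
rewrite mulr_sumr !mulr_sumr; apply: eq_big_seq => L'; rewrite mem_trees => /eqP hL'.
rewrite /root_functional /= hL hL' subnKC; last by rewrite -ltnS.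
ring.
Qed.

End BstMean.

Section JointLaw.
Context d (Omega : measurableType d) (R : realType) (P : probability Omega R).
Variable E : word -> {RV P >-> R}.
Hypothesis Elaw : forall u, has_law P (E u) (exponential_prob (1 : R)).
Hypothesis Eind : mutually_independent P E.
Variables (B : {RV P >-> R}) (xi_ B_ : bool -> {RV P >-> R}).
Local Notation pr := (prob P).
Local Notation expect := (expect P).

Definition subclocks i : word -> {RV P >-> R} := fun u => E (i :: u).

Lemma subclocks_ind i : mutually_independent P (subclocks i).
Proof.
move=> s A us mA.
have := Eind (s := map (cons i) s) (A := fun u => A (behead u)) _ _.
rewrite big_map /=.
have -> : \bigcap_(u in [set` map (cons i) s]) (E u @^-1` A (behead u)) =
    \bigcap_(u in [set` s]) (subclocks i u @^-1` A u).
  apply/seteqP; split=> w /= h u /=.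
    by move=> us'; apply: (h (i :: u)); rewrite /= map_f.
  by move=> /mapP[v vs ->]; exact: (h v vs).
by apply=> //; rewrite map_inj_uniq // => x y [].
Qed.

Hypothesis cvg_B : {ae P, forall w,
  bst_derivative_martingale (yule (clocks E w)) n 1 @[n --> \oo] --> B w}.
Hypothesis cvg_xi_ : forall i, {ae P, forall w,
  (expR (- s) * (nleaves (subtree (yule (clocks E w)) i s))%:R) @[s --> +oo] --> xi_ i w}.
Hypothesis cvg_B_ : forall i, {ae P, forall w,
  bst_derivative_martingale (subtree (yule (clocks E w)) i) n 1 @[n --> \oo] --> B_ i w}.

Lemma ae_good_subclocks : {ae P, forall w, forall i, good_clocks (below [:: i] (clocks E w))}.
Proof.
have h i : {ae P, forall w, good_clocks (below [:: i] (clocks E w))}.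
  by have := @ae_good_clocks _ _ _ P (subclocks i) (fun u => Elaw (i :: u)) (@subclocks_ind i).
by apply: (filterS2 _ _ (h true) (h false)) => w h1 h0 [].
Qed.

(** Each subtree is the Yule process driven by the clocks below its root, so
    that positivity of the limits comes from the result for the whole process. *)
Lemma ae_xi_gt0 : {ae P, forall w, forall i, 0 < xi_ i w}.
Proof.
have h i : {ae P, forall w, 0 < xi_ i w}.
  apply: (@ae_limit_gt0 _ _ _ P (subclocks i) (fun u => Elaw (i :: u)) (@subclocks_ind i)).
  apply: (filterS2 _ _ (cvg_xi_ i) (ae_good_clocks Elaw Eind)) => w h gw.
  by move: h; rewrite subtree_yule.
by apply: (filterS2 _ _ (h true) (h false)) => w h1 h0 [].
Qed.

Definition share : Omega -> R := fun w => xi_ false w / (xi_ false w + xi_ true w).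

Lemma measurable_share : measurable_fun setT share.
Proof.
apply: measurable_funM; first exact: measurable_funP.
by apply: measurable_fun_inv; apply: measurable_funD; exact: measurable_funP.
Qed.

Definition regular w : Prop :=
  [/\ good_clocks (clocks E w), forall i, good_clocks (below [:: i] (clocks E w)),
      forall i, 0 < xi_ i w,
      forall i, (expR (- s) * (nleaves (subtree (yule (clocks E w)) i s))%:R)
                  @[s --> +oo] --> xi_ i w
    & forall i, bst_derivative_martingale (subtree (yule (clocks E w)) i) n 1
                  @[n --> \oo] --> B_ i w].

Lemma ae_regular : {ae P, forall w, regular w}.
Proof.
have cx : {ae P, forall w, forall i, (expR (- s) * (nleaves (subtree (yule (clocks E w)) i s))%:R)
                  @[s --> +oo] --> xi_ i w}.
  by apply: (filterS2 _ _ (cvg_xi_ true) (cvg_xi_ false)) => w h1 h0 [].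
have cb : {ae P, forall w, forall i,
    bst_derivative_martingale (subtree (yule (clocks E w)) i) n 1 @[n --> \oo] --> B_ i w}.
  by apply: (filterS2 _ _ (cvg_B_ true) (cvg_B_ false)) => w h1 h0 [].
have h : {ae P, forall w, [/\ good_clocks (clocks E w),
    forall i, (expR (- s) * (nleaves (subtree (yule (clocks E w)) i s))%:R)
                  @[s --> +oo] --> xi_ i w
    & forall i, bst_derivative_martingale (subtree (yule (clocks E w)) i) n 1
                  @[n --> \oo] --> B_ i w]}.
  by apply: (filterS3 _ _ (ae_good_clocks Elaw Eind) cx cb) => w.
by apply: (filterS3 _ _ ae_good_subclocks ae_xi_gt0 h) => w h1 h2 [].
Qed.

Section TestFunctions.
Variables f g h : R -> R.
Hypotheses (cf : continuous f) (cg : continuous g) (ch : continuous h).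
Hypotheses (f1 : forall x, `|f x| <= 1) (g1 : forall x, `|g x| <= 1) (h1 : forall x, `|h x| <= 1).

Lemma measurable_test (k : R -> R) (X : Omega -> R) : continuous k ->
  measurable_fun setT X -> measurable_fun setT (k \o X).
Proof.
by move=> ck mX; apply: measurableT_comp => //; exact: continuous_measurable_fun.
Qed.

Lemma cvg_mean_centred (k : R -> R) : continuous k -> (forall x, `|k x| <= 1) ->
  bst_mean n (k \o centred_length R) @[n --> \oo] --> expect (k \o B).
Proof.
move=> ck k1; apply: (cvg_bst_mean Elaw Eind) => //.
- by move=> A; exact: k1.
- by apply: measurable_test => //; exact: measurable_funP.
apply: (filterS2 _ _ (ae_good_clocks Elaw Eind) cvg_B) => w gw cb A hA.
exact: (cvg_comp _ _ (cvg_centred_length gw hA cb) (ck (B w))).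
Qed.

Lemma measurable_joint :
  measurable_fun setT (fun w => f (share w) * (g (B_ false w) * h (B_ true w))).
Proof.
apply: measurable_funM; first exact: (measurable_test cf measurable_share).
apply: measurable_funM.
  by apply: (measurable_test cg (X := B_ false)); exact: measurable_funP.
by apply: (measurable_test ch (X := B_ true)); exact: measurable_funP.
Qed.

Lemma cvg_mean_root :
  bst_mean n.+1 (root_functional f g h) @[n --> \oo] -->
  expect (fun w => f (share w) * (g (B_ false w) * h (B_ true w))).
Proof.
rewrite (cvg_shiftS (fun n => bst_mean n (root_functional f g h))).
apply: (cvg_bst_mean Elaw Eind).
- move=> A; rewrite /root_functional !normrM mulr_ile1 ?mulr_ge0 //.
  by rewrite mulr_ile1.
- exact: measurable_joint.
apply: filterS ae_regular => w [gw gw_ xi0 cx cb] A hA.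
rewrite -(cvg_shiftS (fun n => root_functional f g h (A n))).
have [A0 hA0] := history_ex (gw_ false); have [A1 hA1] := history_ex (gw_ true).
pose A_ i := if i then A1 else A0.
have hA_ i : history (below [:: i] (clocks E w)) (A_ i) by case: i.
apply: cvgM.
  have cs : (inner (left (A n.+1))).+1%:R / n.+2%:R @[n --> \oo] --> share w.
    exact: (@cvg_frac _ _ A (fun i => xi_ i w) gw gw_ hA xi0 cx false).
  apply: (eq_cvgn _ (cvg_comp _ _ cs (@cf (share w)))) => n /=.
  by have [-> _] := hA n.+1.
have cc i := @cvg_centred_child _ _ A A_ (fun i => B_ i w) gw gw_ hA hA_ cb i.
apply: cvgM.
  exact: (cvg_comp _ _ (cc false) (@cg (B_ false w))).
exact: (cvg_comp _ _ (cc true) (@ch (B_ true w))).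
Qed.

End TestFunctions.

Lemma cvg_uniform_mean (f : R -> R) : continuous f -> (forall x, `|f x| <= 1) ->
  uniform_mean f n @[n --> \oo] --> expect (f \o share).
Proof.
move=> cf f1.
have c1 : continuous (fun _ : R => 1 : R) by move=> x; exact: cvg_cst.
have n1 (x : R) : `|1 : R| <= 1 by rewrite normr1.
have := cvg_mean_root cf c1 c1 f1 n1 n1.
have -> : (fun w => f (share w) * (1 * 1)) = f \o share.
  by apply: funext => w; rewrite !mulr1.
apply: eq_cvgn => n; rewrite bst_mean_root; congr (_ * _); apply: eq_bigr => i _.
by rewrite !bst_mean_const !mulr1.
Qed.

(** [bst_mean_root] expresses the expectation at size [n + 1] as an average of
    products, in which the factors for [g] and [h] converge; by Cesaro they can be
    replaced by their limits, and the remaining average is the one for [f]. *)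
Lemma expect_joint (f g h : R -> R) : continuous f -> continuous g -> continuous h ->
  (forall x, `|f x| <= 1) -> (forall x, `|g x| <= 1) -> (forall x, `|h x| <= 1) ->
  expect (fun w => f (share w) * (g (B_ false w) * h (B_ true w))) =
  expect (f \o share) * (expect (g \o B) * expect (h \o B)).
Proof.
move=> cf cg ch f1 g1 h1.
have mg := cvg_mean_centred cg g1; have mh := cvg_mean_centred ch h1.
have b1 n (k : R -> R) : (forall x, `|k x| <= 1) -> `|bst_mean n (k \o centred_length R)| <= 1.
  by move=> k1; apply: bst_mean_norm_le1 => A; exact: k1.
have eg1 : `|expect (g \o B)| <= 1.
  apply: (@ler_cvg_to nat \oo _ R (fun n => `|bst_mean n (g \o centred_length R)|) (fun=> 1)).
  - exact: cvg_norm.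
  - exact: cvg_cst.
  - by apply: nearW => n; exact: b1.
have := cesaro_product (f := fun n i => f (i.+1%:R / n.+2%:R)) _ (fun n => b1 n h h1) eg1 mg mh.
move=> /(_ (fun n i => f1 _)) c0.
pose c := expect (g \o B) * expect (h \o B).
have c1 : bst_mean n.+1 (root_functional f g h) - c * uniform_mean f n @[n --> \oo] -->
    expect (fun w => f (share w) * (g (B_ false w) * h (B_ true w))) - c * expect (f \o share).
  apply: cvgB; first exact: cvg_mean_root.
  by apply: cvgM; [exact: cvg_cst|exact: cvg_uniform_mean].
apply/eqP; rewrite -subr_eq0 [X in _ - X]mulrC -/c; apply/eqP.
apply: (norm_cvg_unique c1); rewrite /=.
by apply: (eq_cvgn _ c0) => n; rewrite bst_mean_root.
Qed.

End JointLaw.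

Section Ramps.
Variable R : realType.

(** Continuous in [x], with limit the indicator of the open ray below [a] as [k]
    tends to infinity. *)
Definition ramp (a : R) (k : nat) (x : R) : R := Num.min 1 (Num.max 0 (k%:R * (a - x))).

Lemma ramp_ge0 a k x : 0 <= ramp a k x.
Proof. by rewrite /ramp le_min ler01 le_max lexx. Qed.

Lemma ramp_le1 a k x : ramp a k x <= 1.
Proof. by rewrite /ramp ge_min lexx. Qed.

Lemma ramp_norm_le1 a k x : `|ramp a k x| <= 1.
Proof. by rewrite ger0_norm ?ramp_ge0 // ramp_le1. Qed.

Lemma ramp_eq0 a k x : a <= x -> ramp a k x = 0.
Proof.
move=> ax; rewrite /ramp max_l ?min_r //.
by rewrite mulr_ge0_le0 // subr_le0.
Qed.

Lemma ramp_eq1 a k x : 1 <= k%:R * (a - x) -> ramp a k x = 1.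
Proof. by move=> h; rewrite /ramp min_l // le_max h orbT. Qed.

Lemma continuous_ramp a k : continuous (ramp a k).
Proof.
move=> x.
have c0 (c : R) : {for x, continuous (fun _ : R => c : R^o)} by exact: cvg_cst.
have cl : {for x, continuous (fun y : R => k%:R * (a - y) : R^o)}.
  apply: cvgM; first exact: cvg_cst.
  by apply: cvgB; [exact: cvg_cst|exact: cvg_id].
exact: (continuous_min (c0 1) (continuous_max (c0 0) cl)).
Qed.

Lemma cvg_ramp a x : ramp a k x @[k --> \oo] --> (\1_[set` `]-oo, a[%R] x : R).
Proof.
rewrite indicE; have [ax|xa] := leP a x.
  rewrite memNset; last by rewrite /= in_itv /=; apply/negP; rewrite -leNgt.
  by under eq_fun do rewrite ramp_eq0 //; exact: cvg_cst.
rewrite mem_set; last by rewrite /= in_itv.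
apply: cvg_near_cst; exists (Num.truncn (a - x)^-1).+1 => // k /= hk.
apply: ramp_eq1; rewrite -ler_pdivrMr ?subr_gt0 // mul1r.
by apply: ltW; apply: lt_le_trans (truncnS_gt _) _; rewrite ler_nat.
Qed.

Lemma ray_count_le (y : R) N : 0 <= y -> (\sum_(i < N) (i.+1%:R < y)%R)%N%:R <= y.
Proof.
move=> y0; suff [h1 h2] : (\sum_(i < N) (i.+1%:R < y)%R <= N)%N /\
    (\sum_(i < N) (i.+1%:R < y)%R)%N%:R <= y by [].
elim: N => [|N [IH1 IH2]]; first by rewrite big_ord0.
rewrite big_ord_recr /=; case: ltP => h.
  split; first by rewrite addn1.
  by apply: le_trans (ltW h); rewrite addn1 ler_nat.
by rewrite addn0; split => //; exact: leqW.
Qed.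

Lemma ray_count_ge (y : R) N : y <= N.+1%:R -> y - 1 <= (\sum_(i < N) (i.+1%:R < y)%R)%N%:R.
Proof.
move=> yN; suff [h1 h2] : (N%:R < y -> (\sum_(i < N) (i.+1%:R < y)%R)%N = N) /\
    (y <= N%:R -> y - 1 <= (\sum_(i < N) (i.+1%:R < y)%R)%N%:R).
  have [/h2 //|/h1 ->] := leP y N%:R.
  by rewrite lerBlDr natr1.
elim: N {yN} => [|N [IH1 IH2]].
  by rewrite big_ord0; split => // h; rewrite lerBlDr add0r (le_trans h).
rewrite big_ord_recr /=; case: ltP => h; split => // h'.
- by rewrite IH1 ?addn1 // (lt_trans _ h) // ltr_nat.
rewrite addn0; have [/IH2 //|/IH1 ->] := leP y N%:R.
by rewrite lerBlDr natr1.
Qed.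

Lemma cvg_ray_share (a : R) : (a * n.+2%:R) / n.+1%:R @[n --> \oo] --> a /\
  (a * n.+2%:R - 1) / n.+1%:R @[n --> \oo] --> a.
Proof.
have c1 : 1 / n.+1%:R @[n --> \oo] --> (0 : R).
  by under eq_fun do rewrite mul1r; exact: cvg_harmonic.
have c2 : (a * n.+2%:R) / n.+1%:R @[n --> \oo] --> a.
  apply: (@eq_cvgn _ (fun n => a * (1 + 1 / n.+1%:R))).
    by move=> n; rewrite -(natr1 n.+1) -mulrA mulrDl divff ?pnatr_eq0.
  rewrite -[X in _ --> X]mulr1; apply: cvgM; first exact: cvg_cst.
  by rewrite -[X in _ --> X]addr0; apply: cvgD => //; exact: cvg_cst.
split=> //; apply: (@eq_cvgn _ (fun n => (a * n.+2%:R) / n.+1%:R - 1 / n.+1%:R)).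
  by move=> n; rewrite mulrBl.
by rewrite -[X in _ --> X]subr0; exact: cvgB.
Qed.

Lemma uniform_mean_le (f : R -> R) a n : 0 <= a ->
  (forall x, f x <= (x < a)%R%:R) -> uniform_mean f n <= (a * n.+2%:R) / n.+1%:R.
Proof.
move=> a0 fa; rewrite /uniform_mean mulrC ler_wpM2r ?invr_ge0 //.
apply: (@le_trans _ _ (\sum_(i < n.+1) (i.+1%:R < a * n.+2%:R)%R)%N%:R); last first.
  by apply: ray_count_le; rewrite mulr_ge0.
rewrite natr_sum; apply: ler_sum => i _; apply: le_trans (fa _) _.
by rewrite ltr_pdivrMr // ltr0n.
Qed.

Lemma uniform_mean_ge (f : R -> R) a n : a <= 1 ->
  (forall x, (x < a)%R%:R <= f x) -> (a * n.+2%:R - 1) / n.+1%:R <= uniform_mean f n.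
Proof.
move=> a1 fa; rewrite /uniform_mean [leRHS]mulrC ler_wpM2r ?invr_ge0 //.
apply: (@le_trans _ _ (\sum_(i < n.+1) (i.+1%:R < a * n.+2%:R)%R)%N%:R).
  by apply: ray_count_ge; rewrite ler_piMl.
rewrite natr_sum; apply: ler_sum => i _; apply: le_trans (fa _).
by rewrite ltr_pdivrMr // ltr0n.
Qed.

Lemma uniform_prob_ray (a : R) :
  uniform_prob (@ltr01 R) [set` `]-oo, a[%R] = (Num.min 1 (Num.max 0 a))%:E.
Proof.
rewrite /uniform_prob integral_uniform_pdf.
rewrite (eq_integral (fun=> 1%E)); last first.
  by move=> x; rewrite inE => -[_ /=]; rewrite in_itv /= => h; rewrite /uniform_pdf h subr0 invr1.
have mI : measurable ([set` `]-oo, a[%R] `&` `[0, 1] : set R) by exact: measurableI.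
rewrite integral_cst // mul1e.
have [a0|a0] := leP a 0.
  rewrite min_r ?ler01 // (_ : _ `&` _ = set0) ?measure0 //.
  apply/seteqP; split=> // x [] /=; rewrite !in_itv /= => xa /andP[x0 _].
  by have := lt_le_trans xa (le_trans a0 x0); rewrite ltxx.
have [a1|a1] := leP 1 a.
  have [a1'|a1'] := eqVneq a 1.
    rewrite (_ : _ `&` _ = `[0, 1[%classic); last first.
      apply/seteqP; split=> x /=; rewrite !in_itv /= a1'.
        by move=> [-> /andP[->]].
      by move=> /andP[-> h]; rewrite h ltW.
    by apply: etrans; [exact: lebesgue_measure_itv|]; rewrite /= lte_fin ltr01 sube0.
  rewrite (_ : _ `&` _ = `[0, 1]%classic); last first.
    apply/seteqP; split=> x /=; rewrite !in_itv /=; first by case.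
    move=> /andP[-> h]; rewrite h; split=> //; apply: le_lt_trans h _.
    by rewrite lt_neqAle a1 eq_sym a1'.
  by apply: etrans; [exact: lebesgue_measure_itv|]; rewrite /= lte_fin ltr01 sube0.
rewrite (_ : _ `&` _ = `[0, a[%classic); last first.
  apply/seteqP; split=> x /=; rewrite !in_itv /=.
    by move=> [-> /andP[->]].
  by move=> /andP[-> h]; rewrite h (ltW (lt_trans h a1)).
by apply: etrans; [exact: lebesgue_measure_itv|]; rewrite /= lte_fin a0 sube0.
Qed.

End Ramps.

Section RootLaw.
Context d (Omega : measurableType d) (R : realType) (P : probability Omega R).
Variable E : word -> {RV P >-> R}.
Hypothesis Elaw : forall u, has_law P (E u) (exponential_prob (1 : R)).
Hypothesis Eind : mutually_independent P E.
Variables (B : {RV P >-> R}) (xi_ B_ : bool -> {RV P >-> R}).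
Local Notation pr := (prob P).
Local Notation expect := (expect P).
Hypothesis cvg_B : {ae P, forall w,
  bst_derivative_martingale (yule (clocks E w)) n 1 @[n --> \oo] --> B w}.
Hypothesis cvg_xi_ : forall i, {ae P, forall w,
  (expR (- s) * (nleaves (subtree (yule (clocks E w)) i s))%:R) @[s --> +oo] --> xi_ i w}.
Hypothesis cvg_B_ : forall i, {ae P, forall w,
  bst_derivative_martingale (subtree (yule (clocks E w)) i) n 1 @[n --> \oo] --> B_ i w}.

HB.instance Definition _ :=
  @isMeasurableFun.Build _ _ _ _ (share xi_) (measurable_share xi_).
Let U : {RV P >-> R} := share xi_.

Local Notation ray x := [set` `]-oo, x[%R].

Lemma measurable_ray (X : {RV P >-> R}) (x : R) : measurable (X @^-1` ray x).
Proof. by apply: measurable_RV; exact: measurable_itv. Qed.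

Lemma expect_cvg (X : nat -> Omega -> R) (A : set Omega) : measurable A ->
  (forall n, measurable_fun setT (X n)) -> (forall n w, `|X n w| <= 1) ->
  (forall w, X n w @[n --> \oo] --> (\1_A w : R)) -> expect (X n) @[n --> \oo] --> pr A.
Proof.
move=> mA mX X1 cX; rewrite -expect_indic //; apply: bounded_convergence => //.
- exact: aeW.
- by apply: aeW => w n; exact: X1.
Qed.

Lemma measurable_ramp (X : {RV P >-> R}) a k : measurable_fun setT (ramp a k \o X).
Proof. by apply: measurable_test; [exact: continuous_ramp|exact: measurable_funP]. Qed.

Lemma cvg_expect_ramp (X : {RV P >-> R}) (a : R) :
  expect (ramp a k \o X) @[k --> \oo] --> pr (X @^-1` ray a).
Proof.
apply: expect_cvg; first exact: measurable_ray.
- by move=> k; exact: measurable_ramp.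
- by move=> k w; exact: ramp_norm_le1.
- by move=> w; exact: cvg_ramp.
Qed.

Lemma prob_rays a b c :
  pr (U @^-1` ray a `&` (B_ false @^-1` ray b `&` B_ true @^-1` ray c)) =
  pr (U @^-1` ray a) * (pr (B @^-1` ray b) * pr (B @^-1` ray c)).
Proof.
have c1 : expect (fun w => ramp a k (U w) * (ramp b k (B_ false w) * ramp c k (B_ true w)))
    @[k --> \oo] --> pr (U @^-1` ray a `&` (B_ false @^-1` ray b `&` B_ true @^-1` ray c)).
  apply: expect_cvg.
  - by do ![apply: measurableI|exact: measurable_ray].
  - move=> k; apply: measurable_funM; first exact: (measurable_ramp U).
    by apply: measurable_funM; exact: measurable_ramp.
  - by move=> k w; rewrite !normrM !mulr_ile1 ?ramp_norm_le1 // mulr_ge0.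
  - by move=> w; rewrite !indicI; do ![apply: cvgM|exact: cvg_ramp].
apply: (norm_cvg_unique c1); rewrite /=.
apply: (@eq_cvgn _ (fun k => expect (ramp a k \o U) *
    (expect (ramp b k \o B) * expect (ramp c k \o B)))).
  move=> k; apply/esym; apply: (expect_joint Elaw Eind cvg_B cvg_xi_ cvg_B_);
    by [exact: continuous_ramp|exact: ramp_norm_le1].
by apply: cvgM; [|apply: cvgM]; exact: cvg_expect_ramp.
Qed.

(** The joint law of the share [U] of the left subtree and of the limits in the
    two subtrees; rays are replaced by measurable sets one coordinate at a time. *)
Lemma joint_law A0 A1 A2 : measurable A0 -> measurable A1 -> measurable A2 ->
  pr (U @^-1` A0 `&` (B_ false @^-1` A1 `&` B_ true @^-1` A2)) =
  pr (U @^-1` A0) * (pr (B @^-1` A1) * pr (B @^-1` A2)).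
Proof.
move=> m0 m1 m2.
have s0 b c : pr (U @^-1` A0 `&` (B_ false @^-1` ray b `&` B_ true @^-1` ray c)) =
    pr (B @^-1` ray b) * pr (B @^-1` ray c) * pr (U @^-1` A0).
  apply: prob_eq_rays => //; first by apply: measurableI; exact: measurable_ray.
    by rewrite mulr_ge0 ?prob_ge0.
  by move=> a; rewrite prob_rays mulrC.
have s1 c : pr (B_ false @^-1` A1 `&` (U @^-1` A0 `&` B_ true @^-1` ray c)) =
    pr (U @^-1` A0) * pr (B @^-1` ray c) * pr (B @^-1` A1).
  apply: prob_eq_rays => //.
  - by apply: measurableI; [exact: measurable_RV|exact: measurable_ray].
  - by rewrite mulr_ge0 ?prob_ge0.
  - by move=> b; rewrite setICA s0; ring.
have s2 : pr (B_ true @^-1` A2 `&` (U @^-1` A0 `&` B_ false @^-1` A1)) =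
    pr (U @^-1` A0) * pr (B @^-1` A1) * pr (B @^-1` A2).
  apply: prob_eq_rays => //.
  - by apply: measurableI; exact: measurable_RV.
  - by rewrite mulr_ge0 ?prob_ge0.
  - by move=> c; rewrite setIC -setIA setICA s1; ring.
by rewrite setIA setIC s2; ring.
Qed.

Lemma prob_B_ i A : measurable A -> pr (B_ i @^-1` A) = pr (B @^-1` A).
Proof.
move=> mA; case: i.
  have := joint_law measurableT measurableT mA.
  by rewrite !preimage_setT !setTI !probT !mul1r.
have := joint_law measurableT mA measurableT.
by rewrite !preimage_setT setTI setIT !probT mul1r mulr1.
Qed.

(** The share takes the values [i / (n + 2)], [1 <= i <= n + 1], uniformly, so the
    proportion of them below [b] is [b] up to [O(1 / n)]; the ramp at [b] lies
    between the indicators of the rays below [b - 1 / k] and [b]. *)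
Lemma prob_share_ray a : pr (U @^-1` ray a) = Num.min 1 (Num.max 0 a).
Proof.
have uni k b : uniform_mean (ramp b k) n @[n --> \oo] --> expect (ramp b k \o U).
  by apply: (cvg_uniform_mean Elaw Eind cvg_xi_ cvg_B_);
    [exact: continuous_ramp|exact: ramp_norm_le1].
have ramp_le b k x : ramp b k x <= (x < b)%R%:R.
  by have [xb|bx] := ltP x b; [exact: ramp_le1|rewrite ramp_eq0].
have le b : 0 <= b -> pr (U @^-1` ray b) <= b.
  move=> b0; apply: (@ler_cvg_to nat \oo _ R (fun k => expect (ramp b k \o U)) (fun=> b)).
  - exact: cvg_expect_ramp.
  - exact: cvg_cst.
  apply: nearW => k; have [c _] := cvg_ray_share b.
  apply: (ler_cvg_to (uni k b) c); apply: nearW => n; apply: uniform_mean_le => //.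
have ge b : b <= 1 -> b <= pr (U @^-1` ray b).
  move=> b1; apply: (@ler_cvg_to nat \oo _ R (fun k => b - k.+1%:R^-1)
     (fun k => expect (ramp b k.+1 \o U))).
  - by rewrite -[X in _ --> X]subr0; apply: cvgB; [exact: cvg_cst|exact: cvg_harmonic].
  - by rewrite (cvg_shiftS (fun k => expect (ramp b k \o U))); exact: cvg_expect_ramp.
  apply: nearW => k; set b' := b - _; have [_ c] := cvg_ray_share b'.
  apply: (ler_cvg_to c (uni k.+1 b)); apply: nearW => n; apply: uniform_mean_ge.
    by rewrite /b' lerBlDr (le_trans b1) // lerDl.
  move=> x; have [xb|_] := ltP x b'; last exact: ramp_ge0.
  rewrite ramp_eq1 // -ler_pdivrMl ?ltr0n // mulr1 lerBrDr -lerBrDl.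
  by apply: ltW.
have le1 b : pr (U @^-1` ray b) <= 1 by apply: prob_le1; exact: measurable_ray.
have [a0|a0] := leP a 0.
  rewrite min_r ?ler01 //; apply/eqP; rewrite eq_le prob_ge0 andbT.
  apply: le_trans (le 0 (lexx _)); apply: prob_le; try exact: measurable_ray.
  by move=> w; rewrite /= !in_itv /= => /lt_le_trans; apply.
have [a1|a1] := leP 1 a; apply/eqP; rewrite eq_le.
  rewrite le1 /=; apply: le_trans (ge 1 (lexx _)) _; apply: prob_le; try exact: measurable_ray.
  by move=> w; rewrite /= !in_itv /= => /lt_le_trans; apply.
by rewrite le ?(ltW a0) //= ge // ltW.
Qed.

Lemma share_uniform : has_law P U (uniform_prob (@ltr01 R)).
Proof.
move=> A mA.
pose m' : {measure set R -> \bar R} := pushforward P U.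
pose mu : {measure set (measurableTypeR R) -> \bar R} := uniform_prob (@ltr01 R).
have mid : measurable_fun setT (fun x : measurableTypeR R => x : R).
  by move=> _ C mC; rewrite setTI.
pose mu' : {measure set R -> \bar R} := pushforward mu (fun x : measurableTypeR R => x : R).
have h := @measure_eq_rays R (m' (measurable_funP U)) (mu' mid).
apply: (h _ _ A mA); first apply: le_lt_trans (ltry 1).
  exact: (probability_le1 P (measurable_RV U measurableT)).
move=> x; apply: etrans (probE P (measurable_ray U x)) _; rewrite prob_share_ray.
exact/esym/uniform_prob_ray.
Qed.

Lemma root_independence : mutually_independent P
  (fun i : 'I_3 => tnth [tuple (U : Omega -> R); (B_ false : Omega -> R);
                                (B_ true : Omega -> R)] i).
Proof.
pose X (i : 'I_3) := tnth [tuple (U : Omega -> R); (B_ false : Omega -> R);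
                                  (B_ true : Omega -> R)] i.
rewrite -[X in mutually_independent _ X]/X => s A us mA.
pose A' i : set R := if i \in s then A i else setT.
have mA' i : measurable (A' i) by rewrite /A'; case: ifP.
pose i0 : 'I_3 := inord 0; pose i1 : 'I_3 := inord 1; pose i2 : 'I_3 := inord 2.
have X0 : X i0 = U by rewrite /X (tnth_nth (U : Omega -> R)) /= inordK.
have X1 : X i1 = B_ false by rewrite /X (tnth_nth (U : Omega -> R)) /= inordK.
have X2 : X i2 = B_ true by rewrite /X (tnth_nth (U : Omega -> R)) /= inordK.
have cases (i : 'I_3) : [\/ i = i0, i = i1 | i = i2].
  case: i => [[|[|[|//]]] hi]; [constructor 1|constructor 2|constructor 3];
    by apply: val_inj; rewrite /= inordK.
have -> : \bigcap_(i in [set` s]) (X i @^-1` A i) =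
    U @^-1` A' i0 `&` (B_ false @^-1` A' i1 `&` B_ true @^-1` A' i2).
  rewrite -X0 -X1 -X2; apply/seteqP; split=> w /=.
    have h' i : (forall j, j \in s -> A j (X j w)) -> A' i (X i w).
      by move=> h; rewrite /A'; case: ifP => // /h.
    by move=> h; split; [|split]; exact: h'.
  move=> [h0 [h1 h2]] i /= si; have : A' i (X i w) by have [->|->|->] := cases i.
  by rewrite /A' si.
have mX i : measurable (X i @^-1` A' i).
  by have [->|->|->] := cases i; rewrite ?X0 ?X1 ?X2; exact: measurable_RV.
have -> : (\prod_(i <- s) P (X i @^-1` A i))%E = (\prod_(i <- s) pr (X i @^-1` A' i))%:E.
  rewrite -prodEFin; apply: eq_big_seq => i si.
  by rewrite -probE // /A' si.
have -> : \prod_(i <- s) pr (X i @^-1` A' i) = \prod_(i : 'I_3) pr (X i @^-1` A' i).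
  rewrite big_uniq //= big_mkcond /=; apply: eq_bigr => i _.
  by case: ifP => // si; rewrite /A' si preimage_setT probT.
rewrite probE; last by do ![apply: measurableI|exact: measurable_RV].
rewrite joint_law // -(prob_B_ false) // -(prob_B_ true) //.
have -> (F : 'I_3 -> R) : \prod_(i : 'I_3) F i = F i0 * (F i1 * F i2).
  rewrite !big_ord_recl big_ord0 mulr1.
  by congr (F _ * (F _ * F _)); apply: val_inj; rewrite /= inordK.
by rewrite X0 X1 X2.
Qed.

End RootLaw.
(** * The theorem *)

Theorem corollary3p6 (R : realType) (d : measure_display)
  (Omega : measurableType d) (P : probability Omega R)
  (* the clocks: independent, exponential of parameter 1 *)
  (E : word -> {RV P >-> R})
  (hElaw : forall u, has_law P (E u) (exponential_prob (1 : R)))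
  (hEind : mutually_independent P E)
  (* the Yule tree process *)
  (T : Omega -> R -> set word)
  (hT : forall w, T w = yule (fun u => E u w))
  (* the almost sure limits *)
  (xi Minf BMinf : {RV P >-> R}) (xi_ BMinf_ : bool -> {RV P >-> R})
  (hxi : {ae P, forall w,
    (expR (- t) * (nleaves (T w t))%:R) @[t --> +oo] --> xi w})
  (hMinf : {ae P, forall w,
    yule_derivative_martingale (T w) t 1 @[t --> +oo] --> Minf w})
  (hBMinf : {ae P, forall w,
    bst_derivative_martingale (T w) n 1 @[n --> \oo] --> BMinf w})
  (hxi_ : forall i : bool, {ae P, forall w,
    (expR (- s) * (nleaves (subtree (T w) i s))%:R) @[s --> +oo] --> xi_ i w})
  (hBMinf_ : forall i : bool, {ae P, forall w,
    bst_derivative_martingale (subtree (T w) i) n 1 @[n --> \oo]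
      --> BMinf_ i w}) :
  let U := fun w => xi_ false w / (xi_ false w + xi_ true w) in
  [/\ {ae P, forall w,
        Minf w = xi w * (BMinf w + 2 * (ln (xi w) + euler_gamma R - 1))},
      {ae P, forall w,
        BMinf w = U w * BMinf_ false w + (1 - U w) * BMinf_ true w
          + 2 * U w * ln (U w) + 2 * (1 - U w) * ln (1 - U w) + 1},
      mutually_independent P
        (fun i : 'I_3 => tnth [tuple U; BMinf_ false : Omega -> R;
                                     BMinf_ true : Omega -> R] i),
      (forall i : bool, has_law P (BMinf_ i) (distribution P BMinf))
    & has_law P U (uniform_prob (@ltr01 R)) ].
Proof.
have hT' w : T w = yule (clocks E w) by exact: hT.
have cvg_B : {ae P, forall w,
    bst_derivative_martingale (yule (clocks E w)) n 1 @[n --> \oo] --> BMinf w}.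
  by apply: filterS hBMinf => w; rewrite hT'.
have cvg_xi_ i : {ae P, forall w, (expR (- s) *
    (nleaves (subtree (yule (clocks E w)) i s))%:R) @[s --> +oo] --> xi_ i w}.
  by apply: filterS (hxi_ i) => w; rewrite hT'.
have cvg_B_ i : {ae P, forall w,
    bst_derivative_martingale (subtree (yule (clocks E w)) i) n 1 @[n --> \oo] --> BMinf_ i w}.
  by apply: filterS (hBMinf_ i) => w; rewrite hT'.
have cvg_xi : {ae P, forall w,
    (expR (- t) * (nleaves (yule (clocks E w) t))%:R) @[t --> +oo] --> xi w}.
  by apply: filterS hxi => w; rewrite hT'.
have cvg_M : {ae P, forall w,
    yule_derivative_martingale (yule (clocks E w)) t 1 @[t --> +oo] --> Minf w}.
  by apply: filterS hMinf => w; rewrite hT'.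
have ae_good := ae_good_clocks hElaw hEind.
have xi_gt0 := ae_limit_gt0 hElaw hEind cvg_xi.
have ae_reg := ae_regular hElaw hEind cvg_xi_ cvg_B_.
move=> U; split.
- have ae_limits : {ae P, forall w, [/\ 0 < xi w,
      (expR (- t) * (nleaves (yule (clocks E w) t))%:R) @[t --> +oo] --> xi w
      & bst_derivative_martingale (yule (clocks E w)) n 1 @[n --> \oo] --> BMinf w]}.
    by apply: (filterS3 _ _ xi_gt0 cvg_xi cvg_B) => w.
  apply: (filterS3 _ _ ae_good cvg_M ae_limits) => w gw cm [x0 cx cb].
  exact: (yule_bst_limits gw x0 cx cm cb).
- apply: (filterS2 _ _ ae_reg cvg_B) => w [gw gw_ x0 cx cb_] cb.
  have [A hA] := history_ex gw.
  have [A0 hA0] := history_ex (gw_ false); have [A1 hA1] := history_ex (gw_ true).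
  have hA_ i : history (below [:: i] (clocks E w)) (if i then A1 else A0) by case: i.
  exact: (@quicksort_limit _ _ A (fun i => if i then A1 else A0) (BMinf w)
    (fun i => xi_ i w) (fun i => BMinf_ i w) gw gw_ hA hA_ x0 cx cb_ cb).
- exact: (root_independence hElaw hEind cvg_B cvg_xi_ cvg_B_).
- move=> i A mA; rewrite probE; last exact: measurable_RV.
  rewrite (prob_B_ hElaw hEind cvg_B cvg_xi_ cvg_B_) //.
  by rewrite -probE //; exact: measurable_RV.
- exact: (share_uniform hElaw hEind cvg_xi_ cvg_B_).
Qed.
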